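(* Let $(A,\phi)$ be a non-commutative probability space with unital linear map $\phi:A\to k$, and let $\Phi$ be its multiplicative extension to $H=\overline T(T(A))$. Let $\kappa,\beta,\rho\in g(A)$ be the infinitesimal characters corresponding respectively to free, boolean and monotone cumulants, i.e. the infinitesimal characters with $\Phi=\epsilon+\kappa\prec\Phi$, $\Phi=\epsilon+\Phi\succ\beta$ and $\Phi=\exp^*(\rho)$. Then \begin{align*} \Phi&=\exp^\prec(\kappa)=\exp^*\big(\Omega'(\kappa)\big)=\exp^\succ\big(-W(-\Omega'(\kappa))\big),\\ \Phi&=\exp^\succ(\beta)=\exp^*\big(-\Omega'(-\beta)\big)=\exp^\prec\big(W(-\Omega'(-\beta))\big),\\ \Phi&=\exp^*(\rho)=\exp^\prec\big(W(\rho)\big)=\exp^\succ\big(-W(-\rho)\big). \end{align*} Consequently $\rho=\Omega'(\kappa)$ and $\beta=-W(-\Omega'(\kappa))$; $\rho=-\Omega'(-\beta)$ and $\kappa=W(-\Omega'(-\beta))$; and $\kappa=W(\rho)$ and $\beta=-W(-\rho)$.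
   Context: $k$ is a field of characteristic zero. A non-commutative probability space $(A,\phi)$ is an associative unital $k$-algebra $A$ (product $\cdot_A$, unit $1_A$) with a $k$-linear form $\phi:A\to k$ with $\phi(1_A)=1$. Double tensor algebra. $T(A)=\bigoplus_{n>0}A^{\otimes n}$ and $\overline T(A)=\bigoplus_{n\ge0}A^{\otimes n}$; the tensor $a_1\otimes\cdots\otimes a_n$ is written as a word $a_1\cdots a_n$ (not to be confused with the product $a_1\cdot_A\cdots\cdot_A a_n$ in $A$). $H:=\overline T(T(A))=\bigoplus_{n\ge0}T(A)^{\otimes n}$ is the unital algebra spanned by bar words $w_1|\cdots|w_m$ ($w_i\in T(A)$), with product the concatenation $|$ and unit $\mathbf 1$ (the empty word is identified with $\mathbf 1$); it is graded by the total number of letters. $H^+:=T(T(A))=\bigoplus_{n>0}T(A)^{\otimes n}$. Coproduct and its splitting. For $S=\{s_1<\cdots<s_p\}\subseteq[n]=\{1,\dots,n\}$ put $a_S:=a_{s_1}\cdots a_{s_p}$, $a_\emptyset:=\mathbf 1$. If $J_1,\dots,J_l$ are the connected components (maximal intervals of consecutive integers, in increasing order) of $[n]\setminus S$, put $a_{J^S_{[n]}}:=a_{J_1}|\cdots|a_{J_l}$ ($=\mathbf 1$ if $S=[n]$). The coproduct $\Delta:H\to H\otimes H$ is given by $\Delta(\mathbf 1)=\mathbf 1\otimes\mathbf 1$, $\Delta(a_1\cdots a_n)=\sum_{S\subseteq[n]}a_S\otimes a_{J^S_{[n]}}$, extended multiplicatively; $\epsilon$ is the counit. $H$ is a connected graded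 Hopf algebra. On words put $\Delta^+_\prec(a_1\cdots a_n):=\sum_{1\in S\subseteq[n]}a_S\otimes a_{J^S_{[n]}}$ and $\Delta^+_\succ(a_1\cdots a_n):=\sum_{1\notin S\subset[n]}a_S\otimes a_{J^S_{[n]}}$, and extend to $H^+$ by $\Delta^+_\prec(a|b)=\Delta^+_\prec(a)\Delta(b)$, $\Delta^+_\succ(a|b)=\Delta^+_\succ(a)\Delta(b)$. Put $\Delta_\prec(a):=\Delta^+_\prec(a)-a\otimes\mathbf 1$ and $\Delta_\succ(a):=\Delta^+_\succ(a)-\mathbf 1\otimes a$ for $a\in H^+$. Products on $\mathcal L_A:=Lin(H,k)$. Convolution: $f*g:=m_k\circ(f\otimes g)\circ\Delta$ ($m_k$ the product of $k$), with unit $\epsilon$. For $f,g\in Lin(H^+,k)$ (viewed as forms on $H$ vanishing at $\mathbf 1$), $f\prec g:=m_k\circ(f\otimes g)\circ\Delta_\prec$, $f\succ g:=m_k\circ(f\otimes g)\circ\Delta_\succ$; half-products with the counit are $f\prec\epsilon=f=\epsilon\succ f$, $\epsilon\prec f=0=f\succ\epsilon$. Then $f*g=f\succ g+f\prec g$ on $Lin(H^+,k)$. Characters. A character is $\Phi\in\mathcal L_A$ with $\Phi(\mathbf 1)=1$ and $\Phi(w_1|w_2)=\Phi(w_1)\Phi(w_2)$ for $w_1,w_2\in H$; $G(A)$ is the set of characters. An infinitesimal character is $\kappa\in\mathcal L_A$ with $\kappa(\mathbf 1)=0$ and $\kappa(w_1|w_2)=0$ for $w_1,w_2\in H^+$;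 $g(A)$ is the set of these. $\phi$ is extended to $T(A)$ by $\phi(a_1\cdots a_n):=\phi(a_1\cdot_A\cdots\cdot_A a_n)$ and then to the character $\Phi$ by $\Phi(\mathbf 1)=1$, $\Phi(w_1|\cdots|w_m):=\phi(w_1)\cdots\phi(w_m)$. Exponentials. For $\alpha\in Lin(H^+,k)$: $\exp^*(\alpha):=\sum_{j\ge0}\frac1{j!}\alpha^{*j}$, $\exp^\prec(\alpha):=\epsilon+\sum_{n>0}\alpha^{\prec n}$, $\exp^\succ(\alpha):=\epsilon+\sum_{n>0}\alpha^{\succ n}$, where $\alpha^{\prec0}=\alpha^{\succ0}=\epsilon$, $\alpha^{\prec n}=\alpha\prec\alpha^{\prec(n-1)}$, $\alpha^{\succ n}=\alpha^{\succ(n-1)}\succ\alpha$ (finite sums when evaluated on any element). It is known that each of the three restricts to a bijection $g(A)\to G(A)$, and that $\exp^\prec(\alpha)$, $\exp^\succ(\alpha)$ are the unique solutions of $X=\epsilon+\alpha\prec X$ and $Z=\epsilon+Z\succ\alpha$; in particular $\kappa,\beta,\rho$ exist and are unique. The values of $\kappa,\beta,\rho$ on a word $a_1\cdots a_n$ are the free, boolean and monotone cumulants of $(a_1,\dots,a_n)$. Pre-Lie Magnus expansion. On $Lin(H^+,k)$ let $f\rhd g:=f\succ g-g\prec f$ (a left pre-Lie product) and $L_{f\rhd}(g):=f\rhd g$. Define $W(f):=\frac{e^{L_{f\rhd}}-1}{L_{f\rhd}}(f)=\sum_{n\ge0}\frac1{(n+1)!}L_{f\rhd}^{n}(f)=f+\frac12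 f\rhd f+\frac16 f\rhd(f\rhd f)+\cdots$. The pre-Lie Magnus expansion $\Omega'$ is defined recursively by $\Omega'(f)=\sum_{m\ge0}\frac{B_m}{m!}L_{\Omega'(f)\rhd}^{m}(f)=f-\frac12 f\rhd f+\cdots$ with $B_m$ the Bernoulli numbers ($B_1=-\frac12$); it is the compositional inverse of $W$. All these series reduce to finite sums when evaluated on any element. *)

(* Defs.v *)
From HB Require Import structures.
From mathcomp Require Import all_boot all_order all_algebra.
From mathcomp Require Import finmap.
From mathcomp Require Import boolp classical_sets functions fsbigop.
From mathcomp.multinomials Require Import monalg.

Set Implicit Arguments.
Unset Strict Implicit.
Unset Printing Implicit Defensive.

Import GRing.Theory.
Local Open Scope ring_scope.
Local Open Scope quotient_scope.

Section Span.
Variables (k : fieldType) (V : lmodType k) (R : V -> Prop).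

(* The submodule generated by R: the intersection of the submodules          *)
(* containing R.                                                             *)
Definition span_of : {pred V} := [pred v | `[< forall P : V -> Prop,
  P 0 -> (forall (a : k) x y, P x -> P y -> P (a *: x + y)) ->
  (forall r, R r -> P r) -> P v >]].

Lemma span_ofP v : reflect (forall P : V -> Prop,
  P 0 -> (forall (a : k) x y, P x -> P y -> P (a *: x + y)) ->
  (forall r, R r -> P r) -> P v) (v \in span_of).
Proof. exact: asboolP. Qed.

Lemma span_of_submod : submod_closed span_of.
Proof.
split=> [|a x y /span_ofP hx /span_ofP hy]; apply/span_ofP => P P0 PL PR //.
by apply: (PL); [exact: hx|exact: hy].
Qed.

Lemma mem_span_of r : R r -> r \in span_of.
Proof. by move=> Rr; apply/span_ofP => P P0 PL PR; apply: PR. Qed.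

HB.instance Definition _ := GRing.isSubmodClosed.Build k V span_of span_of_submod.

Definition quotmod : Type := Quotient.quot span_of.
HB.instance Definition _ := GRing.Zmodule.on quotmod.

Definition qpi (v : V) : quotmod := \pi_(Quotient.quot span_of) v.
Definition qrepr (q : quotmod) : V := repr (q : Quotient.quot span_of).

Lemma qreprK q : qpi (qrepr q) = q. Proof. exact: reprK. Qed.

Lemma eq_qpi u v : (qpi u = qpi v) <-> (u - v \in span_of).
Proof. by split=> [/eqP|h]; [|apply/eqP]; rewrite -Quotient.idealrBE. Qed.

Lemma qpiD u v : qpi (u + v) = qpi u + qpi v.
Proof. exact: (Quotient.pi_add span_of). Qed.

Lemma span_ofZ a v : v \in span_of -> a *: v \in span_of.
Proof. by move=> hv; rewrite rpredZ. Qed.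

Definition qscale (a : k) (q : quotmod) : quotmod := qpi (a *: qrepr q).

Lemma qpi_scale a v : qpi (a *: v) = qscale a (qpi v).
Proof.
by apply/eq_qpi; rewrite -scalerBr span_ofZ //; apply/eq_qpi; rewrite qreprK.
Qed.

Lemma qscaleA a b q : qscale a (qscale b q) = qscale (a * b) q.
Proof. by rewrite -[q]qreprK -!qpi_scale scalerA. Qed.
Lemma qscale1 : left_id 1 qscale.
Proof. by move=> q; rewrite -[q]qreprK -!qpi_scale scale1r. Qed.
Lemma qscaleDr : right_distributive qscale +%R.
Proof.
by move=> a p q; rewrite -[q]qreprK -[p]qreprK -qpiD -!qpi_scale scalerDr qpiD.
Qed.
Lemma qscaleDl q : {morph qscale^~ q : a b / a + b}.
Proof. by move=> a b; rewrite -[q]qreprK -!qpi_scale scalerDl qpiD. Qed.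

HB.instance Definition _ :=
  GRing.Zmodule_isLmodule.Build k quotmod qscaleA qscale1 qscaleDr qscaleDl.

Lemma qpi_linear : linear qpi.
Proof. by move=> a u v; rewrite qpiD qpi_scale. Qed.
HB.instance Definition _ := GRing.isLinear.Build k V quotmod *:%R qpi qpi_linear.

Lemma qrepr_pi v : qrepr (qpi v) - v \in span_of.
Proof. by apply/eq_qpi; rewrite qreprK. Qed.

End Span.

Section Presented.
Variables (k : fieldType) (X : choiceType) (R : {malg k[X]} -> Prop).

Definition gen (x : X) : quotmod R := qpi R << x >>.

Definition linext (W : lmodType k) (f : X -> W) (z : {malg k[X]}) : W :=
  \sum_(x <- msupp z) z@_x *: f x.

(* The linear map sending the generator x to f x; it is meaningful (linear,  *)
(* with these values) when f respects the relations, see lift_linear and     *)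
(* lift_gen.                                                                 *)
Definition lift (W : lmodType k) (f : X -> W) (q : quotmod R) : W :=
  linext f (qrepr q).

Definition respects (W : lmodType k) (f : X -> W) :=
  forall r, R r -> linext f r = 0.

Section Theory.
Variables (W : lmodType k) (f : X -> W).

Lemma linextE (D : {fset X}) (z : {malg k[X]}) :
  (msupp z `<=` D)%fset -> linext f z = \sum_(x <- D) z@_x *: f x.
Proof.
move=> sD; rewrite /linext (big_fset_incl _ sD) //.
by move=> x _ /mcoeff_outdom ->; rewrite scale0r.
Qed.

Lemma linext_linear : linear (linext f).
Proof.
move=> a u v.
pose D := (msupp u `|` msupp v `|` msupp (a *: u + v))%fset.
have su : (msupp u `<=` D)%fset by rewrite /D -fsetUA fsubsetUl.
have sv : (msupp v `<=` D)%fset.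
  by rewrite /D (fsetUC (msupp u)) -fsetUA fsubsetUl.
have sw : (msupp (a *: u + v) `<=` D)%fset by rewrite /D fsubsetUr.
rewrite (linextE su) (linextE sv) (linextE sw) scaler_sumr -big_split /=.
by apply: eq_bigr => x _; rewrite mcoeffD mcoeffZ scalerDl scalerA.
Qed.
HB.instance Definition _ :=
  GRing.isLinear.Build k {malg k[X]} W *:%R (linext f) linext_linear.

Lemma linextU x : linext f << x >> = f x.
Proof.
by rewrite (linextE msuppU_le) big_seq_fset1 mcoeffUU scale1r.
Qed.

Hypothesis fR : respects f.

Lemma linext_span v : v \in span_of R -> linext f v = 0.
Proof.
move/span_ofP/(_ (fun v => linext f v = 0)); apply=> //; first exact: linear0.
by move=> a x y hx hy; rewrite linearP /= hx hy scaler0 addr0.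
Qed.

Lemma lift_pi v : lift f (qpi R v) = linext f v.
Proof. by rewrite /lift; apply/eqP; rewrite -subr_eq0 -linearB /= linext_span // qrepr_pi. Qed.

Lemma lift_linear : linear (lift f).
Proof.
move=> a p q; rewrite -[p]qreprK -[q]qreprK -[_ *: _ + _]linearP.
by rewrite !lift_pi linearP.
Qed.

Lemma lift_gen x : lift f (gen x) = f x.
Proof. by rewrite lift_pi linextU. Qed.

End Theory.

Lemma lift_comb (W : lmodType k) (f g h : X -> W) a q :
  (forall x, f x = a *: g x + h x) -> lift f q = a *: lift g q + lift h q.
Proof.
move=> fgh; rewrite /lift /linext scaler_sumr -big_split /=.
by apply: eq_bigr => x _; rewrite fgh scalerDr !scalerA mulrC.
Qed.

Lemma pres_ind (P : quotmod R -> Prop) :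
  P 0 -> (forall a x q, P q -> P (a *: gen x + q)) -> forall q, P q.
Proof.
move=> P0 PS q; rewrite -[q]qreprK (monalgE (qrepr q)) linear_sum /=.
elim: (X in \sum_(_ <- X) _) => [|x s IH]; first by rewrite big_nil.
rewrite big_cons.
have -> : << (qrepr q)@_x *g x >> = (qrepr q)@_x *: (<< x >> : {malg k[X]}).
  by apply/malgP => y; rewrite mcoeffZ !mcoeffU mulrnAr mulr1.
by rewrite linearZ; apply: PS.
Qed.

Lemma lift_unique (W : lmodType k) (f g : quotmod R -> W) :
  linear f -> linear g -> (forall x, f (gen x) = g (gen x)) -> f =1 g.
Proof.
move=> lf lg fg.
pose F := HB.pack_for {linear quotmod R -> W} f (GRing.isLinear.Build _ _ _ _ f lf).
pose G := HB.pack_for {linear quotmod R -> W} g (GRing.isLinear.Build _ _ _ _ g lg).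
suff FG : F =1 G by [].
elim/pres_ind => [|a x q IH]; first by rewrite !linear0.
by rewrite !linearP IH /= fg.
Qed.

End Presented.

Section TensorAlgebra.
Variables (k : fieldType) (V : lmodType k).

Definition multilin_rel (r : {malg k[seq V]}) : Prop :=
  exists (u v : seq V) (a : k) (x y : V),
    r = << u ++ (a *: x + y) :: v >>
        - (a *: << u ++ x :: v >> + << u ++ y :: v >>).

Definition tensAlg : Type := quotmod multilin_rel.
HB.instance Definition _ := GRing.Lmodule.on tensAlg.

Definition tens (u : seq V) : tensAlg := gen multilin_rel u.

Definition multilinear (W : lmodType k) (f : seq V -> W) :=
  forall u v a x y,
    f (u ++ (a *: x + y) :: v) = a *: f (u ++ x :: v) + f (u ++ y :: v).

Definition tlift (W : lmodType k) (f : seq V -> W) (x : tensAlg) : W := lift f x.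

Lemma multilinear_respects (W : lmodType k) (f : seq V -> W) :
  multilinear f -> respects multilin_rel f.
Proof.
move=> fm r [u [v [a [x [y ->]]]]].
by rewrite linearB linearP /= !linextU fm subrr.
Qed.

Lemma tlift_linear (W : lmodType k) (f : seq V -> W) :
  multilinear f -> linear (tlift f).
Proof. by move/multilinear_respects/lift_linear. Qed.

Lemma tliftE (W : lmodType k) (f : seq V -> W) u :
  multilinear f -> tlift f (tens u) = f u.
Proof. by move/multilinear_respects/lift_gen. Qed.

Lemma tens_multilinear : multilinear tens.
Proof.
move=> u v a x y; rewrite /tens /gen -linearP; apply/eq_qpi/mem_span_of.
by exists u, v, a, x, y.
Qed.

Lemma tens_ind (P : tensAlg -> Prop) :
  P 0 -> (forall a u q, P q -> P (a *: tens u + q)) -> forall q, P q.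
Proof. exact: pres_ind. Qed.

Definition tmul (x y : tensAlg) : tensAlg :=
  tlift (fun u => tlift (fun v => tens (u ++ v)) y) x.

Let mlr u : multilinear (fun v => tens (u ++ v)).
Proof. by move=> u' v a x y; rewrite !catA tens_multilinear. Qed.

Let mll y : multilinear (fun u => tlift (fun v => tens (u ++ v)) y).
Proof.
by move=> u v a x x'; apply: lift_comb => w; rewrite -!catA !cat_cons tens_multilinear.
Qed.

Lemma tmul_tens u v : tmul (tens u) (tens v) = tens (u ++ v).
Proof. by rewrite /tmul (tliftE _ (@mll _)) (tliftE _ (mlr _)). Qed.

Lemma tmul_linl y : linear (tmul^~ y).
Proof. exact: tlift_linear (@mll y). Qed.

Lemma tmul_linr x : linear (tmul x).
Proof.
by move=> a y z; apply: lift_comb => u; exact: tlift_linear (mlr u) _ _ _.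
Qed.

Lemma tens_ext (W : lmodType k) (f g : tensAlg -> W) :
  linear f -> linear g -> (forall u, f (tens u) = g (tens u)) -> f =1 g.
Proof. exact: lift_unique. Qed.

Lemma linear_comp (U1 U2 U3 : lmodType k) (f : U1 -> U2) (g : U2 -> U3) :
  linear f -> linear g -> linear (g \o f).
Proof. by move=> lf lg a x y /=; rewrite lf lg. Qed.

Lemma tmulA : associative tmul.
Proof.
have E1 u v : tmul (tens u) \o tmul (tens v) =1 tmul (tmul (tens u) (tens v)).
  apply: tens_ext => [||w].
  - exact: linear_comp (tmul_linr _) (tmul_linr _).
  - exact: tmul_linr.
  by rewrite /= !tmul_tens catA.
have E2 u z : tmul (tens u) \o tmul^~ z =1 tmul^~ z \o tmul (tens u).
  apply: tens_ext => [||v].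
  - exact: linear_comp (tmul_linl z) (tmul_linr _).
  - exact: linear_comp (tmul_linr _) (tmul_linl z).
  exact: (E1 u v z).
have E3 y z : tmul^~ (tmul y z) =1 tmul^~ z \o tmul^~ y.
  apply: tens_ext => [||u].
  - exact: tmul_linl.
  - exact: linear_comp (tmul_linl y) (tmul_linl z).
  exact: (E2 u z y).
by move=> x y z; exact: (E3 y z x).
Qed.

Lemma tmul1 : left_id (tens [::]) tmul.
Proof. by apply: tens_ext => [||u]; [exact: tmul_linr| |rewrite tmul_tens]. Qed.

Lemma tmulr1 : right_id (tens [::]) tmul.
Proof. by apply: tens_ext => [||u]; [exact: tmul_linl| |rewrite tmul_tens cats0]. Qed.

Lemma tmulDl : left_distributive tmul +%R.
Proof. by move=> x y z; have := tmul_linl z 1 x y; rewrite !scale1r. Qed.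

Lemma tmulDr : right_distributive tmul +%R.
Proof. by move=> x y z; have := tmul_linr x 1 y z; rewrite !scale1r. Qed.

(* The projection on the component of degree 0.                              *)
Definition teps (x : tensAlg) : k := tlift (fun u => (nilp u)%:R : k^o) x.

Let nilp_multilinear : multilinear (fun u : seq V => (nilp u)%:R : k^o).
Proof. by case=> [|b u] v a x y /=; rewrite scaler0 addr0. Qed.

Lemma teps_linear : scalar teps.
Proof. exact: tlift_linear nilp_multilinear. Qed.

Lemma teps_tens u : teps (tens u) = (nilp u)%:R.
Proof. exact: tliftE nilp_multilinear. Qed.

Lemma tens0_neq0 : tens [::] != 0.
Proof.
apply/eqP => /(congr1 teps); rewrite teps_tens.
have /= := teps_linear (-1) 0 0; rewrite scaler0 addr0 mulN1r addNr => ->.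
by move/eqP; rewrite oner_eq0.
Qed.

HB.instance Definition _ := GRing.Zmodule_isNzRing.Build tensAlg
  tmulA tmul1 tmulr1 tmulDl tmulDr tens0_neq0.

Lemma tens_scaleAl (a : k) (x y : tensAlg) : a *: (x * y) = (a *: x) * y.
Proof.
have h0 : tmul 0 y = 0 := mul0r (y : tensAlg).
by have := tmul_linl y a x 0; rewrite h0 !addr0.
Qed.

HB.instance Definition _ := GRing.Lmodule_isLalgebra.Build k tensAlg tens_scaleAl.

Lemma tens_scaleAr (a : k) (x y : tensAlg) : a *: (x * y) = x * (a *: y).
Proof.
have h0 : tmul x 0 = 0 := mulr0 (x : tensAlg).
by have := tmul_linr x a y 0; rewrite h0 !addr0.
Qed.

HB.instance Definition _ := GRing.Lalgebra_isAlgebra.Build k tensAlg tens_scaleAr.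

Lemma tens_nil : tens [::] = 1. Proof. by []. Qed.
Lemma tens_cat u v : tens (u ++ v) = tens u * tens v.
Proof. by rewrite -tmul_tens. Qed.

HB.instance Definition _ :=
  GRing.isLinear.Build k tensAlg k *%R teps teps_linear.

(* T(V) is the kernel of the projection on the component of degree 0; tensAug *)
(* is the corresponding type, so that words in T(V) can be formed.            *)
Definition taug : {pred tensAlg} := [pred x | teps x == 0].

Lemma taug_submod : submod_closed taug.
Proof.
split=> [|a x y]; rewrite !inE; first by rewrite linear0.
by move=> /eqP hx /eqP hy; rewrite teps_linear hx hy mulr0 addr0.
Qed.
HB.instance Definition _ := GRing.isSubmodClosed.Build k tensAlg taug taug_submod.

Record tensAug : Type := TensAug { aug_val : tensAlg; _ : aug_val \in taug }.
HB.instance Definition _ := [isSub for aug_val].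
HB.instance Definition _ := [Choice of tensAug by <:].
HB.instance Definition _ := [SubChoice_isSubLmodule of tensAug by <:].

Lemma tens_aug x u : tens (x :: u) \in taug.
Proof. by rewrite inE teps_tens. Qed.

Definition tword (x : V) (u : seq V) : tensAug := TensAug (tens_aug x u).

End TensorAlgebra.

Section TensorProduct.
Variables (k : fieldType) (V W : algType k).

Definition bilin_rel (r : {malg k[(V * W)%type]}) : Prop :=
  (exists (a : k) (x x' : V) (y : W),
    r = << (a *: x + x', y) >> - (a *: << (x, y) >> + << (x', y) >>)) \/
  (exists (a : k) (x : V) (y y' : W),
    r = << (x, a *: y + y') >> - (a *: << (x, y) >> + << (x, y') >>)).

Definition tensProd : Type := quotmod bilin_rel.
HB.instance Definition _ := GRing.Lmodule.on tensProd.

Definition tprod (x : V) (y : W) : tensProd := gen bilin_rel (x, y).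

Definition plift (U : lmodType k) (f : V * W -> U) (p : tensProd) : U := lift f p.

Definition bilin (U : lmodType k) (f : V * W -> U) :=
  (forall y, linear (fun x => f (x, y))) /\ (forall x, linear (fun y => f (x, y))).

Lemma bilin_respects (U : lmodType k) (f : V * W -> U) :
  bilin f -> respects bilin_rel f.
Proof.
case=> fl fr r [[a [x [x' [y ->]]]]|[a [x [y [y' ->]]]]];
  by rewrite linearB linearP /= !linextU ?fl ?fr subrr.
Qed.

Lemma plift_linear (U : lmodType k) (f : V * W -> U) : bilin f -> linear (plift f).
Proof. by move/bilin_respects/lift_linear. Qed.

Lemma pliftE (U : lmodType k) (f : V * W -> U) x y :
  bilin f -> plift f (tprod x y) = f (x, y).
Proof. by move=> /bilin_respects fR; exact: (lift_gen fR). Qed.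

Lemma tprod_bilin : bilin (fun p => tprod p.1 p.2).
Proof.
split=> z a x y /=; rewrite /tprod /gen -linearP; apply/eq_qpi/mem_span_of.
  by left; exists a, x, y, z.
by right; exists a, z, x, y.
Qed.

Lemma tprod_linl y : linear (tprod^~ y).
Proof. exact: tprod_bilin.1 y. Qed.

Lemma tprod_linr x : linear (tprod x).
Proof. exact: tprod_bilin.2 x. Qed.

Lemma tprod_ext (U : lmodType k) (f g : tensProd -> U) :
  linear f -> linear g -> (forall x y, f (tprod x y) = g (tprod x y)) -> f =1 g.
Proof. by move=> lf lg fg; apply: lift_unique => // -[x y]; exact: fg. Qed.

End TensorProduct.

Section TensorProductAlgebra.
Variables (k : fieldType) (B C : algType k).
Local Notation BC := (tensProd B C).

Definition pmul (p q : BC) : BC :=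
  plift (fun u => plift (fun v => tprod (u.1 * v.1) (u.2 * v.2)) q) p.

Let mlr u : bilin (fun v : B * C => tprod (u.1 * v.1) (u.2 * v.2)).
Proof.
split=> z a x y /=; rewrite mulrDr -scalerAr.
  by rewrite tprod_linl.
by rewrite tprod_linr.
Qed.

Let mll q : bilin (fun u : B * C => plift (fun v => tprod (u.1 * v.1) (u.2 * v.2)) q).
Proof.
split=> z a x y /=; apply: lift_comb => -[v1 v2] /=; rewrite mulrDl -scalerAl.
  by rewrite tprod_linl.
by rewrite tprod_linr.
Qed.

Lemma pmul_tprod x y x' y' : pmul (tprod x y) (tprod x' y') = tprod (x * x') (y * y').
Proof. by rewrite /pmul (pliftE _ _ (mll _)) (pliftE _ _ (mlr _)). Qed.

Lemma pmul_linl q : linear (pmul^~ q).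
Proof. exact: plift_linear (mll q). Qed.

Lemma pmul_linr p : linear (pmul p).
Proof. by move=> a y z; apply: lift_comb => u; exact: plift_linear (mlr u) _ _ _. Qed.

Lemma pmulA : associative pmul.
Proof.
have E1 u u' v v' :
    pmul (tprod u u') \o pmul (tprod v v') =1 pmul (pmul (tprod u u') (tprod v v')).
  apply: tprod_ext => [||w w'].
  - exact: linear_comp (pmul_linr _) (pmul_linr _).
  - exact: pmul_linr.
  by rewrite /= !pmul_tprod !mulrA.
have E2 u u' r : pmul (tprod u u') \o pmul^~ r =1 pmul^~ r \o pmul (tprod u u').
  apply: tprod_ext => [||v v'].
  - exact: linear_comp (pmul_linl r) (pmul_linr _).
  - exact: linear_comp (pmul_linr _) (pmul_linl r).
  exact: (E1 u u' v v' r).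
have E3 q r : pmul^~ (pmul q r) =1 pmul^~ r \o pmul^~ q.
  apply: tprod_ext => [||u u'].
  - exact: pmul_linl.
  - exact: linear_comp (pmul_linl q) (pmul_linl r).
  exact: (E2 u u' r q).
by move=> p q r; exact: (E3 q r p).
Qed.

Lemma pmul1 : left_id (tprod 1 1) pmul.
Proof.
by apply: tprod_ext => [||u v]; [exact: pmul_linr| |rewrite pmul_tprod !mul1r].
Qed.

Lemma pmulr1 : right_id (tprod 1 1) pmul.
Proof.
by apply: tprod_ext => [||u v]; [exact: pmul_linl| |rewrite pmul_tprod !mulr1].
Qed.

Lemma pmulDl : left_distributive pmul +%R.
Proof. by move=> x y z; have := pmul_linl z 1 x y; rewrite !scale1r. Qed.

Lemma pmulDr : right_distributive pmul +%R.
Proof. by move=> x y z; have := pmul_linr x 1 y z; rewrite !scale1r. Qed.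

End TensorProductAlgebra.

HB.instance Definition _ (k : fieldType) (B C : algType k) :=
  GRing.Zmodule_isPzRing.Build (tensProd B C)
    (@pmulA k B C) (@pmul1 k B C) (@pmulr1 k B C) (@pmulDl k B C) (@pmulDr k B C).

Lemma tprodM (k : fieldType) (B C : algType k) (x x' : B) (y y' : C) :
  tprod x y * tprod x' y' = tprod (x * x') (y * y').
Proof. exact: pmul_tprod. Qed.

Section DoubleTensor.
Variables (k : fieldType) (A : algType k).

(* The double tensor algebra H(A); its product is the concatenation of bar   *)
(* words, and tens ws is the bar word with entries ws.                       *)
Definition dtens : algType k := tensAlg (tensAug A).
Definition dtens2 : Type := tensProd dtens dtens.
HB.instance Definition _ := GRing.Lmodule.on dtens2.
HB.instance Definition _ := GRing.PzRing.on dtens2.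
End DoubleTensor.

Section Coproduct.
Variables (k : fieldType) (A : algType k).
Local Notation H := (dtens A).
Local Notation HH := (dtens2 A).

(* The word a_1 ... a_n of A seen in H, the empty word being 1.              *)
Definition hword (a : seq A) : H :=
  if a is x :: a' then tens [:: tword x a'] else 1.

Definition hbar (ws : seq (seq A)) : H := \prod_(w <- ws) hword w.

(* A subset S of the positions of a word is encoded by its indicator, a      *)
(* sequence of booleans, so that mask S a is a_S. The list gaps [::] S a     *)
(* consists of the subwords of a supported by the maximal intervals of the   *)
(* complement of S, from left to right; acc holds the interval being read.   *)
Definition flush (T : Type) (acc : seq T) (r : seq (seq T)) :=
  if nilp acc then r else acc :: r.

Fixpoint gaps (T : Type) (acc : seq T) (S : bitseq) (a : seq T) : seq (seq T) :=
  match S, a with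
  | b :: S', x :: a' =>
      if b then flush acc (gaps [::] S' a') else gaps (rcons acc x) S' a'
  | _, _ => flush acc [::]
  end.

Definition cop_term (S : bitseq) (a : seq A) : HH :=
  tprod (hword (mask S a)) (hbar (gaps [::] S a)).

Definition cop_sum (P : pred bitseq) (n : nat) (a : seq A) : HH :=
  \sum_(S : n.-tuple bool | P S) cop_term S a.

Definition cop_word (a : seq A) : HH := cop_sum predT (size a) a.

(* The letter of index 1 is in S when head false S holds.                    *)
Definition prec_word (a : seq A) : HH := cop_sum (head false) (size a) a.
Definition succ_word (a : seq A) : HH := cop_sum (predC (head false)) (size a) a.

Definition cop1 (w : tensAug A) : HH := tlift cop_word (aug_val w).
Definition prec1 (w : tensAug A) : HH := tlift prec_word (aug_val w).
Definition succ1 (w : tensAug A) : HH := tlift succ_word (aug_val w).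

Definition Delta (x : H) : HH := tlift (fun ws => \prod_(w <- ws) cop1 w) x.

(* The maps defined on H^+ are extended to H by 0 at the unit.               *)
Definition Delta_prec_plus (x : H) : HH :=
  tlift (fun ws => if ws is w :: ws' then prec1 w * \prod_(w' <- ws') cop1 w'
                   else 0) x.
Definition Delta_succ_plus (x : H) : HH :=
  tlift (fun ws => if ws is w :: ws' then succ1 w * \prod_(w' <- ws') cop1 w'
                   else 0) x.

(* The projection of H onto H^+ along the unit. *)
Definition hplus (x : H) : H := x - (teps x)%:A.

Definition Delta_prec (x : H) : HH := Delta_prec_plus x - tprod (hplus x) 1.
Definition Delta_succ (x : H) : HH := Delta_succ_plus x - tprod 1 (hplus x).

Lemma hword_multilinear : multilinear hword.
Proof.
have aux (x y z : tensAug A) a : aug_val x = a *: aug_val y + aug_val z ->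
    tens [:: x] = a *: tens [:: y] + tens [:: z].
  move=> e; have -> : x = a *: y + z by apply: val_inj; rewrite /= e.
  exact: (tens_multilinear [::] [::]).
case=> [|b u] v a x y; apply: aux; first exact: (tens_multilinear [::]).
exact: (tens_multilinear (b :: u)).
Qed.

Lemma gaps_true (T : Type) (acc u v : seq T) m1 m2 z : size m1 = size u ->
  gaps acc (m1 ++ true :: m2) (u ++ z :: v) = gaps acc m1 u ++ gaps [::] m2 v.
Proof.
elim: u m1 acc => [|b u IH] [|c m1] acc //=.
  by rewrite /flush; case: (nilp acc).
by move=> [e]; case: c; rewrite IH // /flush; case: (nilp acc).
Qed.

Lemma gaps_false (T : Type) (acc u v : seq T) m1 m2 : size m1 = size u ->
  exists L p q R, forall z,
  gaps acc (m1 ++ false :: m2) (u ++ z :: v) = L ++ (p ++ z :: q) :: R.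
Proof.
elim: u m1 acc => [|b u IH] [|c m1] acc //=.
  move=> _; suff [q [R E]] : exists q R, forall p : seq T, ~~ nilp p ->
      gaps p m2 v = (p ++ q) :: R.
    exists [::], acc, q, R => z; rewrite E; last by rewrite /nilp size_rcons.
    by rewrite cat_rcons.
  elim: v m2 => [|y v IH] [|[] m2] /=;
    try by (exists [::], [::]; case=> //= *; rewrite cats0).
    by exists [::], (gaps [::] m2 v); case=> //= *; rewrite cats0.
  have [q [R E]] := IH m2; exists (y :: q), R => p _.
  by rewrite E ?cat_rcons // /nilp size_rcons.
move=> [e]; case: c; last exact: IH.
have [L [p [q [R E]]]] := IH m1 [::] e; rewrite /flush.
case: (nilp acc); first by exists L, p, q, R.
by exists (acc :: L), p, q, R => z; rewrite E.
Qed.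

Lemma cop_sum_multilinear P : multilinear (fun a => cop_sum P (size a) a).
Proof.
move=> u v a x y; rewrite !size_cat /=; set n := (_ + _)%N.
rewrite /cop_sum scaler_sumr -big_split /=; apply: eq_bigr => S _.
have sS : size (drop (size u) S) = (size v).+1.
  by rewrite size_drop size_tuple /n addKn.
case E : (drop (size u) S) sS => [|b m2] //= [sm2].
have sm1 : size (take (size u) S) = size u.
  by rewrite size_takel // size_tuple leq_addr.
rewrite -(cat_take_drop (size u) S) E; move: (take _ _) sm1 => m1 sm1.
rewrite /cop_term !mask_cat // /=; case: b {E} => /=.
  by rewrite !gaps_true // hword_multilinear tprod_linl.
have [L [p [q [R gE]]]] := gaps_false [::] v m2 sm1.
rewrite !gE /hbar !big_cat !big_cons /= hword_multilinear.
by rewrite mulrDl mulrDr -scalerAl -scalerAr tprod_linr.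
Qed.

Lemma tlift_aug_linear (f : seq A -> HH) :
  multilinear f -> linear (fun w : tensAug A => tlift f (aug_val w)).
Proof. by move=> fm a x y; rewrite /= (tlift_linear fm). Qed.

Lemma cop_word_multilinear : multilinear cop_word.
Proof. exact: (cop_sum_multilinear predT). Qed.
Lemma prec_word_multilinear : multilinear prec_word.
Proof. exact: (cop_sum_multilinear (head false)). Qed.
Lemma succ_word_multilinear : multilinear succ_word.
Proof. exact: (cop_sum_multilinear (predC (head false))). Qed.

Lemma cop1_linear : linear cop1.
Proof. exact: (tlift_aug_linear cop_word_multilinear). Qed.
Lemma prec1_linear : linear prec1.
Proof. exact: (tlift_aug_linear prec_word_multilinear). Qed.
Lemma succ1_linear : linear succ1.
Proof. exact: (tlift_aug_linear succ_word_multilinear). Qed.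

Lemma cop1E x u : cop1 (tword x u) = cop_word (x :: u).
Proof. exact: (tliftE (x :: u) cop_word_multilinear). Qed.
Lemma prec1E x u : prec1 (tword x u) = prec_word (x :: u).
Proof. exact: (tliftE (x :: u) prec_word_multilinear). Qed.
Lemma succ1E x u : succ1 (tword x u) = succ_word (x :: u).
Proof. exact: (tliftE (x :: u) succ_word_multilinear). Qed.

Lemma dtens2_mull (r : HH) : linear (fun p : HH => p * r).
Proof. exact: pmul_linl. Qed.
Lemma dtens2_mulr (r : HH) : linear (fun p : HH => r * p).
Proof. exact: pmul_linr. Qed.

Lemma cop_multilinear :
  multilinear (fun ws : seq (tensAug A) => \prod_(w <- ws) cop1 w).
Proof.
move=> u v a x y; rewrite !big_cat !big_cons /= cop1_linear.
by rewrite dtens2_mull dtens2_mulr.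
Qed.

Lemma half_multilinear (f : tensAug A -> HH) : linear f ->
  multilinear (fun ws : seq (tensAug A) =>
    if ws is w :: ws' then f w * \prod_(w' <- ws') cop1 w' else 0).
Proof.
move=> lf [|b u] v a x y /=; first by rewrite lf dtens2_mull.
by rewrite cop_multilinear dtens2_mulr.
Qed.

Lemma Delta_linear : linear Delta.
Proof. exact: tlift_linear cop_multilinear. Qed.
Lemma Delta_prec_plus_linear : linear Delta_prec_plus.
Proof. exact: tlift_linear (half_multilinear prec1_linear). Qed.
Lemma Delta_succ_plus_linear : linear Delta_succ_plus.
Proof. exact: tlift_linear (half_multilinear succ1_linear). Qed.

Lemma Delta1 : Delta 1 = 1.
Proof. by rewrite -tens_nil [LHS](tliftE _ cop_multilinear) big_nil. Qed.

Lemma DeltaM x y : Delta (x * y) = Delta x * Delta y.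
Proof.
have cm (r : HH) : linear (fun p : HH => r * p) := pmul_linr r.
have cl (r : HH) : linear (fun p : HH => p * r) := pmul_linl r.
have hm (r : H) : linear (fun p : H => r * p) := tmul_linr r.
have hl (r : H) : linear (fun p : H => p * r) := tmul_linl r.
pose F y := Delta \o (fun x => x * y); pose G y := (fun p => p * Delta y) \o Delta.
apply: (@tens_ext _ _ _ (F y) (G y) _ _ _ x) => [||u].
- exact: linear_comp (hl y) Delta_linear.
- exact: linear_comp Delta_linear (cl (Delta y)).
pose F' y := Delta (tens u * y); pose G' y := Delta (tens u) * Delta y.
apply: (@tens_ext _ _ _ F' G' _ _ _ y) => [||v].
- exact: linear_comp (hm (tens u)) Delta_linear.
- exact: linear_comp Delta_linear (cm (Delta (tens u))).
rewrite /F' /G' -tens_cat ![Delta (tens _)](tliftE _ cop_multilinear).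
by rewrite big_cat.
Qed.

Lemma Delta_hword a : Delta (hword a) = cop_word a.
Proof.
case: a => [|x a] /=.
  rewrite Delta1 /cop_word /cop_sum (big_pred1 [tuple]) => [|t].
    by rewrite /cop_term /hbar big_nil.
  by apply/esym/eqP; exact: (tuple0 t).
rewrite [LHS](tliftE _ cop_multilinear) big_cons big_nil mulr1.
exact: cop1E.
Qed.

Lemma Delta_prec_plusM x a w : Delta_prec_plus (hword (x :: a) * w) =
  prec_word (x :: a) * Delta w.
Proof.
pose F w : HH := Delta_prec_plus (hword (x :: a) * w).
pose G w : HH := prec_word (x :: a) * Delta w.
apply: (@tens_ext _ _ _ F G _ _ _ w) => [||v].
- exact: linear_comp (tmul_linr (hword (x :: a))) Delta_prec_plus_linear.
- exact: linear_comp Delta_linear (pmul_linr _).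
rewrite /F /G /hword -tens_cat.
rewrite [LHS](tliftE _ (half_multilinear prec1_linear)) /= prec1E.
by rewrite [Delta _](tliftE _ cop_multilinear).
Qed.

Lemma Delta_succ_plusM x a w : Delta_succ_plus (hword (x :: a) * w) =
  succ_word (x :: a) * Delta w.
Proof.
pose F w : HH := Delta_succ_plus (hword (x :: a) * w).
pose G w : HH := succ_word (x :: a) * Delta w.
apply: (@tens_ext _ _ _ F G _ _ _ w) => [||v].
- exact: linear_comp (tmul_linr (hword (x :: a))) Delta_succ_plus_linear.
- exact: linear_comp Delta_linear (pmul_linr _).
rewrite /F /G /hword -tens_cat.
rewrite [LHS](tliftE _ (half_multilinear succ1_linear)) /= succ1E.
by rewrite [Delta _](tliftE _ cop_multilinear).
Qed.

Lemma Delta_prec_plus1 : Delta_prec_plus 1 = 0.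
Proof. by rewrite -tens_nil [LHS](tliftE _ (half_multilinear prec1_linear)). Qed.

Lemma Delta_succ_plus1 : Delta_succ_plus 1 = 0.
Proof. by rewrite -tens_nil [LHS](tliftE _ (half_multilinear succ1_linear)). Qed.

End Coproduct.

(* Linear forms are functions H -> k together with the predicate scalar; the *)
(* algebraic operations on them are pointwise.                               *)
Section Forms.
Variables (k : fieldType) (A : algType k).
Local Notation H := (dtens A).
Local Notation HH := (dtens2 A).
Local Notation form := (H -> k^o).
Implicit Types (f g : form) (x : H).

Definition eps : form := fun x => teps x.

(* The composite of f (x) g with the product of k. *)
Definition tform f g (z : HH) : k^o := plift (fun p => f p.1 * g p.2 : k^o) z.

Definition conv f g : form := fun x => tform f g (Delta x).

Definition half_prec0 f g : form := fun x => tform f g (Delta_prec x).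
Definition half_succ0 f g : form := fun x => tform f g (Delta_succ x).

(* The half-products < and > of forms vanishing at 1, half_prec0 and          *)
(* half_succ0, are extended bilinearly to forms f = f(1) eps + fplus f with   *)
(* f < eps = f = eps > f and eps < f = 0 = f > eps when f(1) = 0; those of    *)
(* eps with itself are never needed and set to 0.                             *)
Definition fplus f : form := f - f 1 *: eps.

Definition half_prec f g : form := half_prec0 (fplus f) (fplus g) + g 1 *: fplus f.
Definition half_succ f g : form := half_succ0 (fplus f) (fplus g) + f 1 *: fplus g.

(* H^+ as a subspace of H. *)
Definition haug : {pred H} := @taug k (tensAug A).

Definition infinitesimal_character f :=
  [/\ scalar f, f 1 = 0 &
      forall x y, x \in haug -> y \in haug -> f (x * y) = 0].

(* The pointwise sum of a sequence of forms, finitely many of which are      *)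
(* nonzero at any given element.                                             *)
Definition fsum (u : nat -> form) : form :=
  fun x => \sum_(n \in [set: nat]) u n x.

Definition exp_conv f : form := fsum (fun j => (j`!%:R)^-1 *: iter j (conv f) eps).
Definition exp_prec f : form := eps + fsum (fun n => iter n.+1 (half_prec f) eps).
Definition exp_succ f : form := eps + fsum (fun n => iter n.+1 (half_succ^~ f) eps).

Definition prelie f g : form := half_succ f g - half_prec g f.

Definition Wmap f : form :=
  fsum (fun n => (n.+1`!%:R)^-1 *: iter n (prelie f) f).

(* The sequence B_0, ..., B_(n-1), from the recurrence                       *)
(* sum_(j <= m) 'C(m+1, j) B_j = (m == 0).                                   *)
Fixpoint bernoullis (n : nat) : seq k :=
  if n is m.+1 then
    let s := bernoullis m in
    rcons s ((m == 0%N)%:R - (m.+1%:R)^-1 * \sum_(j < m) 'C(m.+1, j)%:R * s`_j)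
  else [::].
Definition bernoulli (n : nat) : k := (bernoullis n.+1)`_n.

(* The recursive equation determines g degree by degree: the terms m > 0 at  *)
(* an element of degree n only involve the values of g in degree < n.        *)
Definition is_magnus f g :=
  [/\ scalar g, g 1 = 0 &
      g = fsum (fun m => (bernoulli m / m`!%:R) *: iter m (prelie g) f)].

Definition Omega f : form := xget 0 [set g | is_magnus f g]%classic.

Section MultiplicativeExtension.
Variable phi : {scalar A}.

Definition phi_word (w : tensAug A) : k :=
  tlift (fun a : seq A => phi (\prod_(x <- a) x) : k^o) (aug_val w).

Definition Phi : form :=
  fun x => tlift (fun ws => \prod_(w <- ws) phi_word w : k^o) x.

End MultiplicativeExtension.

End Forms.

Arguments eps {k A} x.

(* Main.v *)
Require Import Defs.
From HB Require Import structures.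
From mathcomp Require Import all_boot all_order all_algebra.
From mathcomp Require Import boolp classical_sets functions fsbigop.
From mathcomp Require Import ring zify.

(** The space of linear forms on H is a dendriform algebra: the half-products
    satisfy (f ≺ g) ≺ h = f ≺ (g * h), (f ≻ g) ≺ h = f ≻ (g ≺ h) and
    f ≻ (g ≻ h) = (f * g) ≻ h. Everything claimed is a formal consequence of
    these three identities, of the unit rules for the counit, and of the
    grading by the number of letters, which makes all series finite on each
    element. Hence the proof has an algebraic half about an abstract filtered
    dendriform algebra and a half that checks these axioms for H.

    Algebraic half. Put X(t) = exp^*(t r) and let L be the operator
    r ▷ _ = r ≻ _ - _ ≺ r. By the dendriform identities, r ≻ (u ≺ v) equals
    L(u) ≺ v + u ≺ (r * v); so both sides of
        e^(tL) r ≺ X(t) = X(t) ≻ r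
    solve the differential equation Y' = r ≻ Y, Y(0) = r, and they agree
    (cauchy_ad). The derivative of W(t r), taken as a series in t with values
    t^(n+1) L^n r / (n+1)!, is e^(tL) r, so that the derivative of
    Y(t) = W(t r) ≺ X(t) is X(t) ≻ r + Y(t) ≺ r; since X' = X * r, the series
    X - ε solves the same equation, and X = ε + W(r) ≺ X (cauchy_W, exp_W).
    An element X congruent to ε modulo positive degree is cancellable on the
    right of ≺ (prec_unit_inj), so the free cumulants are W(r)
    (free_cumulants). Exchanging the two half-products, in reversed order,
    gives another dendriform algebra, in which r ▷ _ becomes (- r) ▷ _; the
    statement just proved becomes X = ε + X ≻ (- W(- r)), and identifies the
    boolean cumulants (boolean_cumulants). Finally r solves the Magnus
    recursion for W(r), because t / (e^t - 1) and (e^t - 1) / t are inverse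
    series (magnus_W), and the recursion determines its solution degree by
    degree (magnus_unique): hence Omega (W r) = r. All nine expressions of Phi
    then follow from the fixed-point equations.

    Coalgebraic half. Bar words are written as sequences of letters and bars.
    In this encoding the coproduct acts letter by letter: it is the
    multiplicative map sending the bar | to | ⊗ | and a letter x to
    x ⊗ | + 1 ⊗ x, since a letter kept on the left cuts the remaining word, so
    that it leaves a bar on the right, and bars that cut off nothing are
    harmless (Delta_bword). Coassociativity, and with it the three dendriform
    identities, is then an induction in which each letter is checked
    separately (usum_coassoc). Since the elements written in this way span H
    (bword_ind), a linear form is determined by its values on them, and the
    abstract statements transfer to linear forms. *)

Set Implicit Arguments.
Unset Strict Implicit.
Unset Printing Implicit Defensive.

Import GRing.Theory.
Local Open Scope ring_scope.

(** * Auxiliary facts on sums, linear maps and Bernoulli numbers *)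

Lemma sum_triangle (V : zmodType) (F : nat -> nat -> V) N :
  \sum_(s < N) \sum_(i < s.+1) F i (s - i)%N =
  \sum_(i < N) \sum_(j < N - i) F i j.
Proof.
elim: N => [|N IH]; first by rewrite !big_ord0.
rewrite big_ord_recr /= IH [RHS]big_ord_recr /= subSnn big_ord1.
rewrite [X in _ + X]big_ord_recr /= subnn addrA -big_split /=; congr (_ + _).
apply: eq_bigr => i _.
by rewrite (subSn (ltnW (ltn_ord i))) big_ord_recr.
Qed.

Section LinearFunctions.
Variables (k : fieldType) (U V : lmodType k) (f : U -> V).
Hypothesis lf : linear f.

Lemma lin_add x y : f (x + y) = f x + f y.
Proof. by have := lf 1 x y; rewrite !scale1r. Qed.

Lemma lin0 : f 0 = 0.
Proof. by apply: (addrI (f 0)); rewrite -lin_add !addr0. Qed.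

Lemma lin_scale a x : f (a *: x) = a *: f x.
Proof. by have := lf a x 0; rewrite lin0 !addr0. Qed.

Lemma lin_opp x : f (- x) = - f x.
Proof. by rewrite -scaleN1r lin_scale scaleN1r. Qed.

Lemma lin_sub x y : f (x - y) = f x - f y.
Proof. by rewrite lin_add lin_opp. Qed.

Lemma lin_sum I (r : seq I) (P : pred I) (E : I -> U) :
  f (\sum_(i <- r | P i) E i) = \sum_(i <- r | P i) f (E i).
Proof. by apply: big_morph; [exact: lin_add|exact: lin0]. Qed.

End LinearFunctions.

Section Bernoulli.
Variable k : fieldType.

Lemma size_bernoullis n : size (bernoullis k n) = n.
Proof. by elim: n => //= n IH; rewrite size_rcons IH. Qed.

Lemma nth_bernoullis n j : (j < n)%N -> (bernoullis k n)`_j = bernoulli k j.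
Proof.
elim: n => // n IH; rewrite ltnS leq_eqVlt => /predU1P[->//|lt_jn].
by rewrite [LHS]nth_rcons size_bernoullis lt_jn IH.
Qed.

Hypothesis char0 : [pchar k] =i pred0.

Lemma natr_neq0 n : (n.+1%:R : k) != 0.
Proof. by rewrite (GRing.pcharf0P _).1. Qed.

Lemma factr_neq0 n : (n`!%:R : k) != 0.
Proof. by rewrite -(prednK (fact_gt0 n)) natr_neq0. Qed.

Lemma bernoulli_rec n :
  \sum_(j < n.+1) 'C(n.+1, j)%:R * bernoulli k j = (n == 0%N)%:R.
Proof.
rewrite big_ord_recr /= binSn {2}/bernoulli /= nth_rcons size_bernoullis.
rewrite ltnn eqxx mulrBr mulrA divff ?natr_neq0 // mul1r.
under [X in _ - X]eq_bigr => i _ do rewrite nth_bernoullis //.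
rewrite addrCA subrr addr0.
by case: n => [|n]; rewrite ?mulr1 // mulr0.
Qed.

(** The coefficient of t^n in t / (e^t - 1) * ((e^t - 1) / t) = 1. *)
Lemma bernoulli_inverse n :
  \sum_(j < n.+1) bernoulli k j / j`!%:R * ((n - j).+1`!%:R)^-1 =
  (n == 0%N)%:R.
Proof.
apply: (mulfI (factr_neq0 n.+1)); rewrite mulr_sumr.
transitivity ((n == 0%N)%:R : k); last first.
  by case: n => [|n]; rewrite ?mulr1 // mulr0.
rewrite -bernoulli_rec; apply: eq_bigr => -[j /=]; rewrite ltnS => le_jn _.
rewrite -(bin_fact (leqW le_jn)) subSn // (natrM _ 'C(n.+1, j)) (natrM _ j`!).
move: (factr_neq0 j) (factr_neq0 (n - j).+1).
move: (j`!%:R : k) ((n - j).+1`!%:R : k) => x y x0 y0.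
by move: (_%:R) (bernoulli k j) => c b; field; rewrite x0 y0.
Qed.

End Bernoulli.

(** * Filtered dendriform algebras *)

(** The filtration stands for the degree: fil n is meant to contain the forms
    that vanish on all elements of degree less than n, so that fil 1 is the
    augmentation ideal and fil_sep says that a form is determined by its values.
    Since a product of the unit with itself is neither a left nor a right
    half-product, prec + succ is the full product only when one factor is in
    fil 1; hence the hypotheses of precA and succA. *)
Record dendriform (k : fieldType) (M : lmodType k) := Dendriform {
  prec : M -> M -> M;
  succ : M -> M -> M;
  dunit : M;
  fil : nat -> M -> Prop;
  prec_linl : forall y, linear (prec^~ y);
  prec_linr : forall x, linear (prec x);
  succ_linl : forall y, linear (succ^~ y);
  succ_linr : forall x, linear (succ x);
  precA : forall x y z, fil 1 y \/ fil 1 z ->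
    prec (prec x y) z = prec x (prec y z + succ y z);
  mixA : forall x y z, prec (succ x y) z = succ x (prec y z);
  succA : forall x y z, fil 1 x \/ fil 1 y ->
    succ (prec x y + succ x y) z = succ x (succ y z);
  prec1r : forall x, fil 1 x -> prec x dunit = x;
  succ1l : forall x, fil 1 x -> succ dunit x = x;
  prec1l : forall x, prec dunit x = 0;
  succ1r : forall x, succ x dunit = 0;
  filT : forall x, fil 0 x;
  fil0 : forall n, fil n 0;
  fil_lin : forall n a x y, fil n x -> fil n y -> fil n (a *: x + y);
  filW : forall n x, fil n.+1 x -> fil n x;
  fil_sep : forall x, (forall n, fil n x) -> x = 0;
  fil_prec : forall p q x y, fil p x -> fil q y -> fil (p + q) (prec x y);
  fil_succ : forall p q x y, fil p x -> fil q y -> fil (p + q) (succ x y)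
}.

Section Theory.
Variables (k : fieldType) (M : lmodType k) (D : dendriform M).

Local Notation "'ε'" := (dunit D).
Local Notation "x ≺ y" := (prec D x y) (at level 40).
Local Notation "x ≻ y" := (succ D x y) (at level 40).
Local Notation fil := (fil D).

Definition dmul x y := x ≺ y + x ≻ y.
Local Notation "x ⋆ y" := (dmul x y) (at level 40).

Definition dprelie x y := x ≻ y - y ≺ x.
Local Notation "x ▷ y" := (dprelie x y) (at level 40).

Lemma mul_linl y : linear (dmul^~ y).
Proof.
move=> a u v; rewrite /dmul (prec_linl D) (succ_linl D).
by rewrite scalerDr addrACA.
Qed.

Lemma mul_linr x : linear (dmul x).
Proof.
move=> a u v; rewrite /dmul (prec_linr D) (succ_linr D).
by rewrite scalerDr addrACA.
Qed.

Lemma pl_linl y : linear (dprelie^~ y).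
Proof.
move=> a u v; rewrite /dprelie (prec_linr D) (succ_linl D).
by rewrite scalerBr opprD addrACA.
Qed.

Lemma pl_linr x : linear (dprelie x).
Proof.
move=> a u v; rewrite /dprelie (prec_linl D) (succ_linr D).
by rewrite scalerBr opprD addrACA.
Qed.

Lemma mulA x y z : fil 1 x -> fil 1 z -> (x ⋆ y) ⋆ z = x ⋆ (y ⋆ z).
Proof.
move=> x1 z1; rewrite {1}/dmul /dmul (lin_add (prec_linl D z)).
rewrite precA; last by right.
rewrite mixA succA; last by left.
by rewrite (lin_add (succ_linr D x)) !addrA.
Qed.

Lemma filD n x y : fil n x -> fil n y -> fil n (x + y).
Proof. by move=> hx hy; rewrite -[x]scale1r; apply: fil_lin. Qed.

Lemma filZ n a x : fil n x -> fil n (a *: x).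
Proof.
by move=> hx; rewrite -[_ *: _]addr0; apply: fil_lin => //; apply: fil0.
Qed.

Lemma filN n x : fil n x -> fil n (- x).
Proof. by move=> hx; rewrite -scaleN1r; apply: filZ. Qed.

Lemma filB n x y : fil n x -> fil n y -> fil n (x - y).
Proof. by move=> hx hy; apply: filD => //; apply: filN. Qed.

Lemma fil_le m n x : (m <= n)%N -> fil n x -> fil m x.
Proof. by move/subnK <-; elim: (n - m)%N => // p IH /filW; apply: IH. Qed.

Lemma fil_sum n I (r : seq I) (P : pred I) (E : I -> M) :
  (forall i, P i -> fil n (E i)) -> fil n (\sum_(i <- r | P i) E i).
Proof. by move=> h; apply: big_ind => //; [exact: fil0|exact: filD]. Qed.

Lemma fil_mul p q x y : fil p x -> fil q y -> fil (p + q) (x ⋆ y).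
Proof. by move=> hx hy; apply: filD; [exact: fil_prec|exact: fil_succ]. Qed.

Lemma fil_pl p q x y : fil p x -> fil q y -> fil (p + q) (x ▷ y).
Proof.
by move=> hx hy; apply: filB; [exact: fil_succ|rewrite addnC; exact: fil_prec].
Qed.

Lemma fil_iter (f : M -> M) p x n :
  (forall q y, fil q y -> fil q.+1 (f y)) -> fil p x ->
  fil (n + p) (iter n f x).
Proof. by move=> hf hx; elim: n => //= n IH; rewrite addSn; apply: hf. Qed.

Lemma fil_iter_pl x p y n : fil 1 x -> fil p y ->
  fil (n + p) (iter n (dprelie x) y).
Proof. by move=> hx; apply: fil_iter => q z hz; apply: (fil_pl hx hz). Qed.

Lemma fil_iter_prec a x n : fil 1 a -> fil n (iter n (prec D a) x).
Proof.
move=> a1; rewrite -[X in fil X]addn0; apply: fil_iter (filT D x).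
by move=> q y hy; exact: (fil_prec a1 hy).
Qed.

Lemma iter_pl_linear x n : linear (iter n (dprelie x)).
Proof.
by elim: n => [|n IH] a u v //=; rewrite IH pl_linr.
Qed.

(** Convergence of a series for the filtration, with the rate that holds when
    its n-th term lies in fil n. *)
Definition sums (u : nat -> M) (x : M) :=
  forall N, fil N (x - \sum_(n < N) u n).

Lemma sums_unique u x y : sums u x -> sums u y -> x = y.
Proof.
move=> hx hy; apply/eqP; rewrite -subr_eq0; apply/eqP/(fil_sep (d := D)) => N.
have -> : x - y = (x - \sum_(n < N) u n) - (y - \sum_(n < N) u n).
  by rewrite opprB addrA subrK.
exact: filB.
Qed.

Lemma sums_fil u x : sums u x ->
  forall p, (forall n, fil (n + p) (u n)) -> fil p x.
Proof.
move=> hx p hu; rewrite -[x](subrK (\sum_(n < p) u n)); apply: filD => //.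
by apply: fil_sum => i _; apply: fil_le (hu i); rewrite leq_addl.
Qed.

(** The coefficients of U(t) ≺ V(t), where u and v are those of U and V. *)
Definition cauchy (u v : nat -> M) n := \sum_(i < n.+1) u i ≺ v (n - i)%N.

Lemma sums_cauchy u v x y : (forall n, fil n (u n)) ->
  sums u x -> sums v y -> sums (cauchy u v) (x ≺ y).
Proof.
move=> hu hx hy N; rewrite /cauchy (sum_triangle (fun i j => u i ≺ v j)).
pose U := \sum_(i < N) u i.
rewrite -[x](subrK U) (lin_add (prec_linl D y)) -addrA; apply: filD.
  by have := fil_prec (hx N) (filT D y); rewrite addn0.
rewrite (lin_sum (prec_linl D y)) -sumrB; apply: fil_sum => i _.
rewrite -(lin_sum (prec_linr D (u i)) _ _ (fun j : 'I_(N - i) => v j)).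
rewrite -(lin_sub (prec_linr D (u i))).
by have := fil_prec (hu i) (hy (N - i)%N); rewrite subnKC // ltnW.
Qed.

(** The Leibniz rule (U ≺ V)' = U' ≺ V + U ≺ V', with u' and v' the
    coefficients of U' and V'; comparing coefficients of derivatives replaces
    the uniqueness of solutions of differential equations. *)
Lemma cauchy_leibniz u v u' v' n :
  (forall i, i.+1%:R *: u i.+1 = u' i) ->
  (forall i, i.+1%:R *: v i.+1 = v' i) ->
  n.+1%:R *: cauchy u v n.+1 = cauchy u' v n + cauchy u v' n.
Proof.
move=> du dv; rewrite /cauchy scaler_sumr.
under eq_bigr => i _.
  rewrite (_ : n.+1%:R = i%:R + (n.+1 - i)%:R :> k); last first.
    by rewrite -natrD subnKC // -ltnS.
  rewrite scalerDl -(lin_scale (prec_linl D _)) -(lin_scale (prec_linr D _)).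
  over.
rewrite big_split /=; congr (_ + _).
  rewrite big_ord_recl /= scale0r (lin0 (prec_linl D _)) add0r.
  by apply: eq_bigr => i _; rewrite /bump add1n du subSS.
rewrite big_ord_recr /= subnn scale0r (lin0 (prec_linr D _)) addr0.
by apply: eq_bigr => i _; rewrite subSn ?dv // -ltnS.
Qed.

Lemma cauchy_mulr u v n r : fil 1 r ->
  cauchy u (fun j => v j ⋆ r) n = cauchy u v n ≺ r.
Proof.
move=> r1; rewrite /cauchy (lin_sum (prec_linl D r)).
by apply: eq_bigr => i _; rewrite precA //; right.
Qed.

(** Left multiplication by r for ≻ acts on U ≺ V as a derivation that is
    r ▷ _ on the left factor and r * _ on the right factor. *)
Lemma cauchy_pl r u v n : fil 1 r ->
  cauchy (fun i => r ▷ u i) v n + cauchy u (fun j => r ⋆ v j) n =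
  r ≻ cauchy u v n.
Proof.
move=> r1; rewrite /cauchy (lin_sum (succ_linr D r)) -big_split /=.
apply: eq_bigr => i _; rewrite /dprelie (lin_sub (prec_linl D _)) mixA.
by rewrite precA ?subrK //; left.
Qed.

(** Iterating x = ε + a ≺ x leaves after N steps a remainder a ≺ (... (a ≺ x)),
    which lies in fil N. *)
Lemma sums_prec_fixpoint a x : fil 1 a -> x = ε + a ≺ x ->
  sums (fun n => iter n.+1 (prec D a) ε) (x - ε).
Proof.
move=> a1 xE N.
have h : x = \sum_(n < N.+1) iter n (prec D a) ε + iter N.+1 (prec D a) x.
  elim: N => [|N IH]; first by rewrite big_ord1 -xE.
  have iter_lin n : linear (iter n (prec D a)).
    by elim: n => [|n IHn] b u v //=; rewrite IHn (prec_linr D).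
  have e : iter N.+1 (prec D a) x =
      iter N.+1 (prec D a) ε + iter N.+2 (prec D a) x.
    by rewrite [iter N.+2 _ x]iterSr -(lin_add (iter_lin N.+1)) -xE.
  by rewrite big_ord_recr -addrA -e.
rewrite {1}h big_ord_recl /= -[ε + _ + _]addrA [ε + _]addrC addrK.
rewrite addrAC subrr add0r.
exact/filW/fil_iter_prec.
Qed.

(** If d ≺ x = 0 then d = - (d ≺ (x - ε)), which is one step deeper in the
    filtration than d. *)
Lemma prec_unit_inj x a b : fil 1 (x - ε) -> fil 1 a -> fil 1 b ->
  a ≺ x = b ≺ x -> a = b.
Proof.
move=> x1 a1 b1 ab; apply/eqP; rewrite -subr_eq0; apply/eqP.
have d1 : fil 1 (a - b) by apply: filB.
have d0 : (a - b) ≺ x = 0 by rewrite (lin_sub (prec_linl D x)) ab subrr.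
apply: (fil_sep (d := D)); elim=> [|n IH]; first exact: filT.
have -> : a - b = - ((a - b) ≺ (x - ε)).
  by rewrite (lin_sub (prec_linr D _)) d0 sub0r prec1r ?opprK.
by apply: filN; rewrite -addn1; apply: fil_prec.
Qed.

(** * Exponentials and the Magnus recursion *)

Section Exponential.
Hypothesis char0 : [pchar k] =i pred0.
Variable r : M.
Hypothesis r1 : fil 1 r.

(** The coefficients of exp^*(t r) and, up to a shift of degree, of W(t r). *)
Definition exp_term n := (n`!%:R)^-1 *: iter n (dmul r) ε.
Definition W_term n := (n.+1`!%:R)^-1 *: iter n (dprelie r) r.

Lemma div_fact n : n.+1%:R * (n.+1`!%:R)^-1 = (n`!%:R)^-1 :> k.
Proof. by rewrite factS natrM invfM mulVKf // natr_neq0. Qed.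

Lemma iter_mulC n : iter n (dmul r) ε ⋆ r = iter n.+1 (dmul r) ε.
Proof.
elim: n => [|n IH].
  by rewrite /= /dmul prec1l add0r succ1l // prec1r // succ1r addr0.
by rewrite iterS mulA // IH.
Qed.

Lemma exp_termS n : n.+1%:R *: exp_term n.+1 = r ⋆ exp_term n.
Proof. by rewrite /exp_term scalerA div_fact /= (lin_scale (mul_linr r)). Qed.

Lemma exp_termSr n : n.+1%:R *: exp_term n.+1 = exp_term n ⋆ r.
Proof.
by rewrite /exp_term scalerA div_fact (lin_scale (mul_linl r)) iter_mulC.
Qed.

Lemma exp_term_fil n : fil n (exp_term n).
Proof.
apply: filZ; rewrite -[X in fil X]addn0; apply: fil_iter; last exact: filT.
by move=> q y hy; exact: (fil_mul r1 hy).
Qed.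

Lemma W_term_fil n : fil n.+1 (W_term n).
Proof. by apply: filZ; rewrite -addn1; exact: fil_iter_pl. Qed.

Lemma exp_term0 : exp_term 0 = ε.
Proof. by rewrite /exp_term invr1 scale1r. Qed.

Let ad n := (n`!%:R)^-1 *: iter n (dprelie r) r.

(** With L = r ▷ _, this is e^(tL) r ≺ exp^*(t r) = exp^*(t r) ≻ r: both sides
    solve Y' = r ≻ Y with the constant term r. *)
Lemma cauchy_ad n : cauchy ad exp_term n = exp_term n ≻ r.
Proof.
have adS i : i.+1%:R *: ad i.+1 = r ▷ ad i.
  by rewrite /ad scalerA div_fact /= (lin_scale (pl_linr r)).
elim: n => [|n IH].
  by rewrite /cauchy big_ord1 exp_term0 succ1l // prec1r /ad invr1 scale1r.
apply: (scalerI (natr_neq0 char0 n)).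
rewrite (cauchy_leibniz _ adS exp_termS) cauchy_pl // IH.
rewrite -(lin_scale (succ_linl D r)) exp_termS succA //; by left.
Qed.

(* The coefficients of W(t r), whose derivative is e^(tL) r. *)
Let W_shift n := if n is m.+1 then W_term m else 0.

(** W(t r) ≺ exp^*(t r) = exp^*(t r) - ε: the derivatives agree because
    exp^*(t r) * r is the sum of exp^*(t r) ≻ r, given by cauchy_ad, and of
    exp^*(t r) ≺ r. *)
Lemma cauchy_W n : cauchy W_shift exp_term n = exp_term n - (n == 0%N)%:R *: ε.
Proof.
have W_shiftS i : i.+1%:R *: W_shift i.+1 = ad i.
  by rewrite /= /W_term scalerA div_fact.
elim: n => [|n IH].
  by rewrite /cauchy big_ord1 (lin0 (prec_linl D _)) exp_term0 scale1r subrr.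
apply: (scalerI (natr_neq0 char0 n)); rewrite scale0r subr0.
rewrite (cauchy_leibniz _ W_shiftS exp_termSr) cauchy_ad cauchy_mulr // IH.
rewrite (lin_sub (prec_linl D r)) (lin_scale (prec_linl D r)) prec1l.
by rewrite scaler0 subr0 exp_termSr /dmul addrC.
Qed.

Theorem exp_W x w : sums exp_term x -> sums W_term w -> x = ε + w ≺ x.
Proof.
move=> hx hw.
have hw0 : sums W_shift w.
  case=> [|N]; first exact: filT.
  rewrite big_ord_recl add0r.
  have -> : w - \sum_(i < N) W_term i = w - \sum_(i < N.+1) W_term i + W_term N.
    by rewrite big_ord_recr /= opprD addrA subrK.
  by apply: filD (hw N.+1) (W_term_fil N).
have W_shift_fil n : fil n (W_shift n).
  by case: n => [|n]; [exact: filT|exact: W_term_fil].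
apply: (sums_unique hx) => N.
case: N => [|N]; first exact: filT.
have := sums_cauchy W_shift_fil hw0 hx N.+1.
under eq_bigr => i _ do rewrite cauchy_W.
rewrite sumrB [X in _ - (_ - X)]big_ord_recl /= scale1r.
rewrite [X in _ - (_ - (_ + X))]big1 => [|i _]; last by rewrite scale0r.
by rewrite addr0 opprB addrCA addrA.
Qed.

Definition magnus_term g f m :=
  (bernoulli k m / m`!%:R) *: iter m (dprelie g) f.

(** Truncating both series, the recursion for r becomes a double sum of
    multiples of L^(m + n) r, whose coefficients are those of
    t / (e^t - 1) * ((e^t - 1) / t). *)
Theorem magnus_W w : sums W_term w -> sums (magnus_term r w) r.
Proof.
move=> hw [|N]; first exact: filT.
pose F m n :=
  (bernoulli k m / m`!%:R * (n.+1`!%:R)^-1) *: iter (m + n) (dprelie r) r.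
have rE : r = \sum_(m < N.+1) \sum_(n < N.+1 - m) F m n.
  have Fs s :
      \sum_(m < s.+1) F m (s - m)%N = (s == 0%N)%:R *: iter s (dprelie r) r.
    rewrite -(bernoulli_inverse char0 s) scaler_suml; apply: eq_bigr => m _.
    by rewrite /F subnKC // -ltnS.
  rewrite -sum_triangle; under eq_bigr => s _ do rewrite Fs.
  rewrite big_ord_recl /= scale1r big1 ?addr0 // => s _.
  by rewrite scale0r.
rewrite {1}rE -sumrB; apply: fil_sum => m _; rewrite /magnus_term.
have Lm := iter_pl_linear r m.
have -> : \sum_(n < N.+1 - m) F m n =
    (bernoulli k m / m`!%:R) *:
      iter m (dprelie r) (\sum_(n < N.+1 - m) W_term n).
  rewrite (lin_sum Lm) scaler_sumr; apply: eq_bigr => n _.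
  by rewrite /F /W_term (lin_scale Lm) scalerA iterD.
rewrite -scalerBr -(lin_sub Lm) -opprB (lin_opp Lm).
apply/filZ/filN; have := fil_iter_pl m r1 (hw (N.+1 - m)%N).
by rewrite subnKC // ltnW.
Qed.

End Exponential.

(** If g - h lies in fil n, then the corresponding terms of the two recursions
    differ by elements of fil n.+1: the terms m = 0 are both f, and each other
    term contains a factor g ▷ _ applied to an element of fil 1. *)
Lemma magnus_unique f g h : fil 1 f -> fil 1 g -> fil 1 h ->
  sums (magnus_term g f) g -> sums (magnus_term h f) h -> g = h.
Proof.
move=> f1 g1 h1 hg hh; apply/eqP; rewrite -subr_eq0; apply/eqP.
apply: (fil_sep (d := D)); elim=> [|n IH]; first exact: filT.
have iterB m : fil n.+1 (iter m (dprelie g) f - iter m (dprelie h) f).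
  elim: m => [|m IHm]; first by rewrite subrr; apply: fil0.
  rewrite !iterS; set a := iter m _ f; set b := iter m _ f.
  have -> : g ▷ a - h ▷ b = (g - h) ▷ a + h ▷ (a - b).
    rewrite (lin_sub (pl_linl a)) (lin_sub (pl_linr h)).
    by rewrite addrA subrK.
  apply: filD; last exact/filW/(fil_pl h1 IHm).
  rewrite -addn1; apply: fil_pl => //.
  by apply: fil_le (fil_iter_pl m g1 f1); rewrite addn1.
have -> : g - h = (g - \sum_(m < n.+1) magnus_term g f m)
    - (h - \sum_(m < n.+1) magnus_term h f m)
    + \sum_(m < n.+1) (magnus_term g f m - magnus_term h f m).
  by rewrite sumrB [RHS]addrACA -opprD !subrK.
apply: filD; first exact: filB.
by apply: fil_sum => m _; rewrite -scalerBr; apply: filZ.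
Qed.

End Theory.

(** * Exchanging the half-products *)

Section Opposite.
Variables (k : fieldType) (M : lmodType k) (D : dendriform M).

Program Definition dendriform_op : dendriform M := {|
  prec x y := succ D y x;
  succ x y := prec D y x;
  dunit := dunit D;
  fil := fil D;
  prec_linl := succ_linr D;
  prec_linr := succ_linl D;
  succ_linl := prec_linr D;
  succ_linr := prec_linl D;
  prec1r := @succ1l _ _ D;
  succ1l := @prec1r _ _ D;
  prec1l := @succ1r _ _ D;
  succ1r := @prec1l _ _ D;
  filT := @filT _ _ D;
  fil0 := @fil0 _ _ D;
  fil_lin := @fil_lin _ _ D;
  filW := @filW _ _ D;
  fil_sep := @fil_sep _ _ D |}.
Next Obligation. by rewrite addrC succA //; tauto. Qed.
Next Obligation. by rewrite mixA. Qed.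
Next Obligation. by rewrite addrC precA //; tauto. Qed.
Next Obligation. by rewrite addnC; apply: fil_succ. Qed.
Next Obligation. by rewrite addnC; apply: fil_prec. Qed.

Lemma exp_term_op r n : fil D 1 r -> exp_term dendriform_op r n = exp_term D r n.
Proof.
move=> r1; congr (_ *: _); elim: n => //= n ->.
by rewrite -[RHS]iterS -iter_mulC // /dmul addrC.
Qed.

(** The pre-Lie product of the opposite structure by r is that of the original
    structure by - r. *)
Lemma W_term_op r n : W_term dendriform_op r n = - W_term D (- r) n.
Proof.
rewrite /W_term -scalerN; congr (_ *: _).
rewrite -[RHS](lin_opp (iter_pl_linear D (- r) n)) opprK.
elim: n => //= n ->; rewrite (lin_opp (pl_linl D _)) /dprelie /=.
by rewrite opprB.
Qed.

End Opposite.

Section Cumulants.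
Variables (k : fieldType) (M : lmodType k) (D : dendriform M).
Hypothesis char0 : [pchar k] =i pred0.
Variables (r x : M).
Hypothesis (r1 : fil D 1 r) (xE : sums D (exp_term D r) x).

Lemma exp_aug : fil D 1 (x - dunit D).
Proof. by have := xE 1; rewrite big_ord1 exp_term0. Qed.

Lemma free_cumulants a w : fil D 1 a -> x = dunit D + prec D a x ->
  sums D (W_term D r) w -> a = w.
Proof.
move=> a1 ax hw; apply: (prec_unit_inj exp_aug a1).
  by apply: (sums_fil hw) => n; rewrite addn1; apply: W_term_fil.
by apply: (addrI (dunit D)); rewrite -ax -(exp_W char0 r1 xE hw).
Qed.

End Cumulants.

Lemma boolean_cumulants (k : fieldType) (M : lmodType k) (D : dendriform M)
    (char0 : [pchar k] =i pred0) r x b w :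
  fil D 1 r -> sums D (exp_term D r) x -> fil D 1 b ->
  x = dunit D + succ D x b ->
  sums D (W_term D (- r)) w -> b = - w.
Proof.
move=> r1 xE b1 bx hw.
apply: (@free_cumulants _ _ (dendriform_op D) char0 r x) => // N.
  under eq_bigr => n _ do rewrite exp_term_op //.
  exact: xE.
under eq_bigr => n _ do rewrite W_term_op.
rewrite sumrN -opprD; exact: (@filN _ _ D _ _ (hw N)).
Qed.

(** * Words with bars and the letterwise coproduct *)

Section Unshuffles.
Variables (T : Type) (V : zmodType).
Local Notation tokens := (seq (option T)).
Implicit Types (l u v : tokens) (F : tokens -> tokens -> V).

Definition deg l := count isSome l.

(** The coproduct of a word over letters (Some x) and bars (None), composed with
    F: each letter goes to the left factor, leaving a bar on the right, or to
    the right factor. In usum_prec and usum_succ the first letter is constrained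
    to go left and right respectively. *)
Fixpoint usum F l : V :=
  match l with
  | [::] => F [::] [::]
  | None :: l' => usum (fun u v => F (None :: u) (None :: v)) l'
  | Some x :: l' => usum (fun u v => F (Some x :: u) (None :: v)) l' +
                    usum (fun u v => F u (Some x :: v)) l'
  end.

Fixpoint usum_prec F l : V :=
  match l with
  | [::] => 0
  | None :: l' => usum_prec (fun u v => F (None :: u) (None :: v)) l'
  | Some x :: l' => usum (fun u v => F (Some x :: u) (None :: v)) l'
  end.

Fixpoint usum_succ F l : V :=
  match l with
  | [::] => 0
  | None :: l' => usum_succ (fun u v => F (None :: u) (None :: v)) l'
  | Some x :: l' => usum (fun u v => F u (Some x :: v)) l'
  end.

Lemma usum_deg F G l :
  (forall u v, (deg u + deg v)%N = deg l -> F u v = G u v) ->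
  usum F l = usum G l.
Proof.
elim: l F G => [|[x|] l IH] F G FG /=; first exact: FG.
  congr (_ + _); apply: IH => u v h; apply: FG => /=; lia.
by apply: IH => u v h; apply: FG.
Qed.

Lemma usum_prec_deg F G l :
  (forall u v, (deg u + deg v)%N = deg l -> F u v = G u v) ->
  usum_prec F l = usum_prec G l.
Proof.
elim: l F G => [|[x|] l IH] F G FG //=.
  apply: usum_deg => u v h; apply: FG => /=; lia.
by apply: IH => u v h; apply: FG.
Qed.

Lemma usum_succ_deg F G l :
  (forall u v, (deg u + deg v)%N = deg l -> F u v = G u v) ->
  usum_succ F l = usum_succ G l.
Proof.
elim: l F G => [|[x|] l IH] F G FG //=.
  apply: usum_deg => u v h; apply: FG => /=; lia.
by apply: IH => u v h; apply: FG.
Qed.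

Lemma eq_usum F G l : (forall u v, F u v = G u v) -> usum F l = usum G l.
Proof. by move=> FG; apply: usum_deg. Qed.
Lemma eq_usum_prec F G l : (forall u v, F u v = G u v) ->
  usum_prec F l = usum_prec G l.
Proof. by move=> FG; apply: usum_prec_deg. Qed.
Lemma eq_usum_succ F G l : (forall u v, F u v = G u v) ->
  usum_succ F l = usum_succ G l.
Proof. by move=> FG; apply: usum_succ_deg. Qed.

Lemma usumD F G l : usum (fun u v => F u v + G u v) l = usum F l + usum G l.
Proof. by elim: l F G => [|[x|] l IH] F G //=; rewrite !IH addrACA. Qed.
Lemma usum_precD F G l :
  usum_prec (fun u v => F u v + G u v) l = usum_prec F l + usum_prec G l.
Proof. by elim: l F G => [|[x|] l IH] F G /=; rewrite ?usumD ?addr0. Qed.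
Lemma usum_succD F G l :
  usum_succ (fun u v => F u v + G u v) l = usum_succ F l + usum_succ G l.
Proof. by elim: l F G => [|[x|] l IH] F G /=; rewrite ?usumD ?addr0. Qed.

Lemma usum_split F l :
  usum F l = usum_prec F l + usum_succ F l + (if deg l == 0%N then F l l else 0).
Proof.
elim: l F => [|[x|] l IH] F /=; first by rewrite !add0r.
  by rewrite addr0.
by rewrite IH.
Qed.

(** Iterating the coproduct either way distributes the letters over three
    factors, where a letter leaves bars in the factors to the right of its
    own. *)
Lemma usum_coassoc (F : tokens -> tokens -> tokens -> V) l :
  usum (fun u w => usum (fun u' v => F u' v w) u) l =
  usum (fun u v => usum (fun v' w => F u v' w) v) l.
Proof. by elim: l F => [|[x|] l IH] F //=; rewrite !usumD !IH addrA. Qed.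

Lemma usum_prec_coassoc (F : tokens -> tokens -> tokens -> V) l :
  usum_prec (fun u w => usum_prec (fun u' v => F u' v w) u) l =
  usum_prec (fun u v => usum (fun v' w => F u v' w) v) l.
Proof. by elim: l F => [|[x|] l IH] F //=; rewrite usum_coassoc. Qed.

Lemma mixed_coassoc (F : tokens -> tokens -> tokens -> V) l :
  usum_prec (fun u w => usum_succ (fun u' v => F u' v w) u) l =
  usum_succ (fun u v => usum_prec (fun v' w => F u v' w) v) l.
Proof. by elim: l F => [|[x|] l IH] F //=; rewrite usum_coassoc. Qed.

Lemma usum_succ_coassoc (F : tokens -> tokens -> tokens -> V) l :
  usum_succ (fun u w => usum (fun u' v => F u' v w) u) l =
  usum_succ (fun u v => usum_succ (fun v' w => F u v' w) v) l.
Proof. by elim: l F => [|[x|] l IH] F //=; rewrite usum_coassoc. Qed.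

Lemma usum_cat F l1 l2 :
  usum F (l1 ++ l2) =
  usum (fun u1 v1 => usum (fun u2 v2 => F (u1 ++ u2) (v1 ++ v2)) l2) l1.
Proof. by elim: l1 F => [|[x|] l1 IH] F //=; rewrite !IH. Qed.

Lemma usum_prec_cat F x l1 l2 :
  usum_prec F ((Some x :: l1) ++ l2) =
  usum_prec (fun u1 v1 => usum (fun u2 v2 => F (u1 ++ u2) (v1 ++ v2)) l2)
    (Some x :: l1).
Proof. exact: usum_cat. Qed.
Lemma usum_succ_cat F x l1 l2 :
  usum_succ F ((Some x :: l1) ++ l2) =
  usum_succ (fun u1 v1 => usum (fun u2 v2 => F (u1 ++ u2) (v1 ++ v2)) l2)
    (Some x :: l1).
Proof. exact: usum_cat. Qed.

Lemma usum_prec_deg0 F l : deg l = 0%N -> usum_prec F l = 0.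
Proof. by elim: l F => [|[x|] l IH] F //=; apply: IH. Qed.
Lemma usum_succ_deg0 F l : deg l = 0%N -> usum_succ F l = 0.
Proof. by elim: l F => [|[x|] l IH] F //=; apply: IH. Qed.

End Unshuffles.

Section Morphism.
Variables (T : Type) (U V : zmodType) (h : U -> V).
Hypothesis hD : forall x y, h (x + y) = h x + h y.
Implicit Types (l u v : seq (option T)).
Implicit Types (F : seq (option T) -> seq (option T) -> U).

Lemma usum_morph F l : h (usum F l) = usum (fun u v => h (F u v)) l.
Proof. by elim: l F => [|[x|] l IH] F //=; rewrite ?hD !IH. Qed.

Let h0 : h 0 = 0. Proof. by apply: (addrI (h 0)); rewrite -hD !addr0. Qed.

Lemma usum_prec_morph F l :
  h (usum_prec F l) = usum_prec (fun u v => h (F u v)) l.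
Proof. by elim: l F => [|[x|] l IH] F //=; rewrite ?usum_morph ?IH. Qed.
Lemma usum_succ_morph F l :
  h (usum_succ F l) = usum_succ (fun u v => h (F u v)) l.
Proof. by elim: l F => [|[x|] l IH] F //=; rewrite ?usum_morph ?IH. Qed.

End Morphism.

(** * The dendriform algebra of functions of words with bars *)

Section TokenForms.
Variables (k : fieldType) (T : Type).

(** These functions need not be compatible with the removal of superfluous bars:
    the dendriform axioms hold for all of them. *)
Definition tokform : lmodType k := seq (option T) -> k^o.
Implicit Types (P Q R : tokform) (l u v : seq (option T)).

Definition tunit : tokform := fun l => (deg l == 0%N)%:R.
Definition tprec P Q : tokform :=
  fun l => usum_prec (fun u v => P u * Q v : k^o) l.
Definition tsucc P Q : tokform :=
  fun l => usum_succ (fun u v => P u * Q v : k^o) l.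
Definition tconv P Q : tokform := fun l => usum (fun u v => P u * Q v : k^o) l.
Definition tfil n P := forall l, (deg l < n)%N -> P l = 0.

Lemma tconv_split P Q : tfil 1 P \/ tfil 1 Q ->
  tconv P Q = tprec P Q + tsucc P Q.
Proof.
move=> h; apply/funext => l; rewrite /tconv usum_split.
case: eqP => [l0|_]; last exact: addr0.
suff -> : P l * Q l = 0 by exact: addr0.
by case: h => ->; rewrite ?mul0r ?mulr0 // l0.
Qed.

Lemma tone_usumr P l : usum (fun u v => P u * tunit v : k^o) l = P l.
Proof.
elim: l P => [|[x|] l IH] P /=;
  first exact: mulr1; last exact: (IH (P \o cons None)).
rewrite [X in X + _](IH (P \o cons (Some x))) /=.
rewrite (@eq_usum _ _ _ (fun _ _ => 0 : k^o)).
  by rewrite -(@usum_morph _ k^o k^o (fun _ => 0)) ?addr0 // => *; rewrite addr0.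
by move=> u v; rewrite /tunit /= mulr0.
Qed.

Lemma tone_usuml P l : usum (fun u v => tunit u * P v : k^o) l = P l.
Proof.
elim: l P => [|[x|] l IH] P /=;
  first exact: mul1r; last exact: (IH (P \o cons None)).
rewrite [X in _ + X](IH (P \o cons (Some x))) /=.
rewrite (@eq_usum _ _ _ (fun _ _ => 0 : k^o)).
  by rewrite -(@usum_morph _ k^o k^o (fun _ => 0)) ?add0r // => *; rewrite addr0.
by move=> u v; rewrite /tunit /= mul0r.
Qed.

Lemma tprec1r P : tfil 1 P -> tprec P tunit = P.
Proof.
move=> P1; apply/funext => l; rewrite /tprec.
case: (posnP (deg l)) => l0; first by rewrite usum_prec_deg0 // P1 // l0.
elim: l P {P1} l0 => [|[x|] l IH] P //= l0; last exact: (IH (P \o cons None) l0).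
exact: (tone_usumr (P \o cons (Some x))).
Qed.

Lemma tsucc1l P : tfil 1 P -> tsucc tunit P = P.
Proof.
move=> P1; apply/funext => l; rewrite /tsucc.
case: (posnP (deg l)) => l0; first by rewrite usum_succ_deg0 // P1 // l0.
elim: l P {P1} l0 => [|[x|] l IH] P //= l0; last exact: (IH (P \o cons None) l0).
exact: (tone_usuml (P \o cons (Some x))).
Qed.

Lemma usum_eq0 (F : seq (option T) -> seq (option T) -> k^o) l :
  (forall u v, (deg u + deg v)%N = deg l -> F u v = 0) -> usum F l = 0.
Proof.
move=> F0; rewrite (usum_deg F0) -(@usum_morph _ k^o k^o (fun _ => 0)) // => *.
by rewrite addr0.
Qed.

Lemma usum_prec_eq0 (F : seq (option T) -> seq (option T) -> k^o) l :
  (forall u v, (deg u + deg v)%N = deg l -> F u v = 0) -> usum_prec F l = 0.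
Proof.
move=> F0; rewrite (usum_prec_deg F0).
rewrite -(@usum_prec_morph _ k^o k^o (fun _ => 0)) // => *.
by rewrite addr0.
Qed.

Lemma usum_succ_eq0 (F : seq (option T) -> seq (option T) -> k^o) l :
  (forall u v, (deg u + deg v)%N = deg l -> F u v = 0) -> usum_succ F l = 0.
Proof.
move=> F0; rewrite (usum_succ_deg F0).
rewrite -(@usum_succ_morph _ k^o k^o (fun _ => 0)) // => *.
by rewrite addr0.
Qed.

Lemma tprec1l P : tprec tunit P = 0.
Proof.
apply/funext => l; rewrite /tprec -[RHS]/(0 : k^o).
elim: l P => [|[x|] l IH] P //=.
by apply: usum_eq0 => u v _; rewrite /tunit mul0r.
Qed.

Lemma tsucc1r P : tsucc P tunit = 0.
Proof.
apply/funext => l; rewrite /tsucc -[RHS]/(0 : k^o).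
elim: l P => [|[x|] l IH] P //=.
by apply: usum_eq0 => u v _; rewrite /tunit mulr0.
Qed.

Local Obligation Tactic := idtac.

Program Definition tok_dendriform : dendriform tokform := {|
  prec := tprec; succ := tsucc; dunit := tunit; fil := tfil;
  prec1r := tprec1r; succ1l := tsucc1l; prec1l := tprec1l; succ1r := tsucc1r |}.
Next Obligation.
move=> Q a P P'; apply/funext => l; rewrite /tprec /= -[RHS]/(_ * _ + _).
rewrite (@usum_prec_morph _ k^o k^o ( *%R a)) => [|*]; last exact: mulrDr.
by rewrite -usum_precD; apply: eq_usum_prec => u v; rewrite mulrA -mulrDl.
Qed.
Next Obligation.
move=> Q a P P'; apply/funext => l; rewrite /tprec /= -[RHS]/(_ * _ + _).
rewrite (@usum_prec_morph _ k^o k^o ( *%R a)) => [|*]; last exact: mulrDr.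
by rewrite -usum_precD; apply: eq_usum_prec => u v; rewrite mulrCA -mulrDr.
Qed.
Next Obligation.
move=> Q a P P'; apply/funext => l; rewrite /tsucc /= -[RHS]/(_ * _ + _).
rewrite (@usum_succ_morph _ k^o k^o ( *%R a)) => [|*]; last exact: mulrDr.
by rewrite -usum_succD; apply: eq_usum_succ => u v; rewrite mulrA -mulrDl.
Qed.
Next Obligation.
move=> Q a P P'; apply/funext => l; rewrite /tsucc /= -[RHS]/(_ * _ + _).
rewrite (@usum_succ_morph _ k^o k^o ( *%R a)) => [|*]; last exact: mulrDr.
by rewrite -usum_succD; apply: eq_usum_succ => u v; rewrite mulrCA -mulrDr.
Qed.
Next Obligation.
move=> P Q R h; rewrite -tconv_split //; apply/funext => l.
transitivity (usum_prec (fun u w =>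
    usum_prec (fun u' v => P u' * Q v * R w : k^o) u) l).
  apply: eq_usum_prec => u w.
  apply: (@usum_prec_morph _ k^o k^o ( *%R^~ (R w))) => *.
  exact: mulrDl.
rewrite (usum_prec_coassoc (fun u v w => P u * Q v * R w : k^o)).
apply: eq_usum_prec => u v.
rewrite [RHS](@usum_morph _ k^o k^o ( *%R (P u))) => [|*].
  by apply: eq_usum => *; rewrite mulrA.
exact: mulrDr.
Qed.
Next Obligation.
move=> P Q R; apply/funext => l.
transitivity (usum_prec (fun u w =>
    usum_succ (fun u' v => P u' * Q v * R w : k^o) u) l).
  apply: eq_usum_prec => u w.
  apply: (@usum_succ_morph _ k^o k^o ( *%R^~ (R w))) => *.
  exact: mulrDl.
rewrite (mixed_coassoc (fun u v w => P u * Q v * R w : k^o)).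
apply: eq_usum_succ => u v.
rewrite [RHS](@usum_prec_morph _ k^o k^o ( *%R (P u))) => [|*].
  by apply: eq_usum_prec => *; rewrite mulrA.
exact: mulrDr.
Qed.
Next Obligation.
move=> P Q R h; rewrite -tconv_split //; apply/funext => l.
transitivity (usum_succ (fun u w =>
    usum (fun u' v => P u' * Q v * R w : k^o) u) l).
  apply: eq_usum_succ => u w.
  apply: (@usum_morph _ k^o k^o ( *%R^~ (R w))) => *.
  exact: mulrDl.
rewrite (usum_succ_coassoc (fun u v w => P u * Q v * R w : k^o)).
apply: eq_usum_succ => u v.
rewrite [RHS](@usum_succ_morph _ k^o k^o ( *%R (P u))) => [|*].
  by apply: eq_usum_succ => *; rewrite mulrA.
exact: mulrDr.
Qed.
Next Obligation. by []. Qed.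
Next Obligation. by []. Qed.
Next Obligation.
by move=> n a P Q hP hQ l hl; rewrite -[LHS]/(_ * _ + _) hP // hQ // mulr0 addr0.
Qed.
Next Obligation. by move=> n P hP l hl; apply: hP; rewrite ltnW. Qed.
Next Obligation. by move=> P hP; apply/funext => l; apply: (hP (deg l).+1). Qed.
Next Obligation.
move=> p q P Q hP hQ l hl; apply: usum_prec_eq0 => u v uv.
case: (ltnP (deg u) p) => hu; first by rewrite hP ?mul0r.
by rewrite hQ ?mulr0 //; lia.
Qed.
Next Obligation.
move=> p q P Q hP hQ l hl; apply: usum_succ_eq0 => u v uv.
case: (ltnP (deg u) p) => hu; first by rewrite hP ?mul0r.
by rewrite hQ ?mulr0 //; lia.
Qed.

End TokenForms.

(** * The coproduct of H on words with bars *)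

Lemma sum_tuple_cons (V : nmodType) n (P : pred bitseq) (G : bitseq -> V) :
  \sum_(S : n.+1.-tuple bool | P S) G S =
  \sum_(S : n.-tuple bool | P (true :: S)) G (true :: S) +
  \sum_(S : n.-tuple bool | P (false :: S)) G (false :: S).
Proof.
rewrite big_mkcond /=.
rewrite (reindex (fun p : bool * n.-tuple bool => [tuple of p.1 :: p.2])) /=.
  rewrite -(pair_bigA _ (fun b (t : n.-tuple bool) =>
    if P (b :: t) then G (b :: t) else 0)) /=.
  by rewrite big_bool -!big_mkcond.
exists (fun t : n.+1.-tuple bool => (thead t, [tuple of behead t])) => t _.
  by case: t => b t /=; congr (_, _); apply: val_inj.
by rewrite [RHS]tuple_eta.
Qed.

Section Runs.
Variables (T : Type) (R : pzRingType) (w : seq T -> R).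
Hypothesis w1 : w [::] = 1.
Implicit Types (a acc : seq T) (l : seq (option T)).

(** The product of the values of w at the maximal runs of letters of l, where acc
    is the run being read. *)
Fixpoint runs acc l : R :=
  match l with
  | [::] => w acc
  | None :: l' => w acc * runs [::] l'
  | Some x :: l' => runs (rcons acc x) l'
  end.

Lemma runs_bar l : runs [::] (None :: l) = runs [::] l.
Proof. by rewrite /= w1 mul1r. Qed.

Lemma runs_cat acc l1 l2 :
  runs acc (l1 ++ None :: l2) = runs acc l1 * runs [::] l2.
Proof. by elim: l1 acc => [|[x|] l1 IH] acc //=; rewrite IH // mulrA. Qed.

Lemma runs_letters acc a l : runs acc (map Some a ++ l) = runs (acc ++ a) l.
Proof. by elim: a acc => [|x a IH] acc /=; rewrite ?cats0 // IH cat_rcons. Qed.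

(** Its runs are the connected components of the complement of S. *)
Definition gap_tokens (S : bitseq) a : seq (option T) :=
  [seq if p.1 then None else Some p.2 | p <- zip S a].

Lemma prod_flush acc r :
  \prod_(v <- flush acc r) w v = w acc * \prod_(v <- r) w v.
Proof. by case: acc => [|x acc]; rewrite /= ?w1 ?mul1r // big_cons. Qed.

Lemma prod_gaps acc S a : size S = size a ->
  \prod_(v <- gaps acc S a) w v = runs acc (gap_tokens S a).
Proof.
elim: S acc a => [|b S IH] acc [|x a] //=.
  by rewrite prod_flush big_nil mulr1.
by case=> hS; case: b; rewrite ?prod_flush IH.
Qed.

Lemma sum_subsets (V : zmodType) (G : seq (option T) -> seq (option T) -> V) a :
  \sum_(S : (size a).-tuple bool) G (map Some (mask S a)) (gap_tokens S a) =
  usum G (map Some a).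
Proof.
elim: a G => [|x a IH] G /=.
  by rewrite (big_pred1 [tuple]) // => t; apply/esym/eqP; exact: tuple0.
rewrite (sum_tuple_cons _ predT
  (fun S => G (map Some (mask S (x :: a))) (gap_tokens S (x :: a)))) /=.
by rewrite -!IH.
Qed.

Lemma sum_subsets_prec (V : zmodType)
    (G : seq (option T) -> seq (option T) -> V) x a :
  \sum_(S : (size (x :: a)).-tuple bool | head false S)
    G (map Some (mask S (x :: a))) (gap_tokens S (x :: a)) =
  usum_prec G (map Some (x :: a)).
Proof.
rewrite (sum_tuple_cons _ (head false)
  (fun S => G (map Some (mask S (x :: a))) (gap_tokens S (x :: a)))) /=.
by rewrite [X in _ + X]big_pred0 // addr0 -sum_subsets.
Qed.

Lemma sum_subsets_succ (V : zmodType)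
    (G : seq (option T) -> seq (option T) -> V) x a :
  \sum_(S : (size (x :: a)).-tuple bool | predC (head false) S)
    G (map Some (mask S (x :: a))) (gap_tokens S (x :: a)) =
  usum_succ G (map Some (x :: a)).
Proof.
rewrite (sum_tuple_cons _ (predC (head false))
  (fun S => G (map Some (mask S (x :: a))) (gap_tokens S (x :: a)))) /=.
by rewrite [X in X + _]big_pred0 // add0r -sum_subsets.
Qed.

End Runs.

Section WordsOfTokens.
Variables (k : fieldType) (A : algType k).
Local Notation H := (dtens A).
Local Notation HH := (dtens2 A).
Local Notation tokens := (seq (option A)).
Implicit Types (a acc : seq A) (l u v : tokens).

Definition hruns : seq A -> tokens -> H := runs (@hword k A).
(** The bar word denoted by a sequence of letters and bars; superfluous bars do
    not change it, as the empty word is the unit. *)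
Definition bword := hruns [::].

Let hword1 : @hword k A [::] = 1. Proof. exact: erefl. Qed.

Lemma hruns_barE acc l : hruns acc (None :: l) = hword acc * bword l.
Proof. exact: erefl. Qed.

Lemma hruns_letterE acc x l : hruns acc (Some x :: l) = hruns (rcons acc x) l.
Proof. exact: erefl. Qed.

Lemma hruns_nil acc : hruns acc [::] = hword acc.
Proof. exact: erefl. Qed.

Lemma bword_bar l : bword (None :: l) = bword l.
Proof. exact: (runs_bar hword1). Qed.

Lemma bword_cat l1 l2 : bword (l1 ++ None :: l2) = bword l1 * bword l2.
Proof. exact: runs_cat. Qed.

Lemma bword_letters a : bword (map Some a) = hword a.
Proof. by rewrite -[map _ _]cats0 /bword /hruns runs_letters. Qed.

Definition btensor u v : HH := tprod (bword u) (bword v).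

Lemma cop_termE a (S : (size a).-tuple bool) :
  cop_term S a = btensor (map Some (mask S a)) (gap_tokens S a).
Proof.
rewrite /cop_term /btensor bword_letters; congr tprod.
by apply: (prod_gaps hword1); rewrite size_tuple.
Qed.

Lemma cop_wordE a : cop_word a = usum btensor (map Some a).
Proof.
rewrite -(sum_subsets btensor); apply: eq_bigr => S _; exact: cop_termE.
Qed.

Lemma prec_wordE x a : prec_word (x :: a) = usum_prec btensor (map Some (x :: a)).
Proof.
rewrite -(sum_subsets_prec btensor); apply: eq_bigr => S _; exact: cop_termE.
Qed.

Lemma succ_wordE x a : succ_word (x :: a) = usum_succ btensor (map Some (x :: a)).
Proof.
rewrite -(sum_subsets_succ btensor); apply: eq_bigr => S _; exact: cop_termE.
Qed.

Lemma btensor_cat u1 u2 v1 v2 :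
  btensor (u1 ++ None :: u2) (v1 ++ None :: v2) = btensor u1 v1 * btensor u2 v2.
Proof. by rewrite /btensor !bword_cat tprodM. Qed.

Let mulDr (r : HH) x y : r * (x + y) = r * x + r * y. Proof. exact: mulrDr. Qed.
Let mulDl (r : HH) x y : (x + y) * r = x * r + y * r. Proof. exact: mulrDl. Qed.

Lemma usum_btensor_cat l1 l2 :
  usum btensor (l1 ++ None :: l2) = usum btensor l1 * usum btensor l2.
Proof.
rewrite usum_cat [RHS](usum_morph (mulDl _)); apply: eq_usum => u1 v1.
rewrite -[LHS]/(usum
  (fun u2 v2 => btensor (u1 ++ None :: u2) (v1 ++ None :: v2)) l2).
rewrite [RHS](usum_morph (mulDr _)); apply: eq_usum => u2 v2.
exact: btensor_cat.
Qed.

Lemma usum_prec_btensor_cat x l1 l2 :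
  usum_prec btensor ((Some x :: l1) ++ None :: l2) =
  usum_prec btensor (Some x :: l1) * usum btensor l2.
Proof.
rewrite usum_prec_cat [RHS](usum_prec_morph (mulDl _)).
apply: eq_usum_prec => u1 v1.
rewrite -[LHS]/(usum
  (fun u2 v2 => btensor (u1 ++ None :: u2) (v1 ++ None :: v2)) l2).
rewrite [RHS](usum_morph (mulDr _)); apply: eq_usum => u2 v2.
exact: btensor_cat.
Qed.

Lemma usum_succ_btensor_cat x l1 l2 :
  usum_succ btensor ((Some x :: l1) ++ None :: l2) =
  usum_succ btensor (Some x :: l1) * usum btensor l2.
Proof.
rewrite usum_succ_cat [RHS](usum_succ_morph (mulDl _)).
apply: eq_usum_succ => u1 v1.
rewrite -[LHS]/(usum
  (fun u2 v2 => btensor (u1 ++ None :: u2) (v1 ++ None :: v2)) l2).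
rewrite [RHS](usum_morph (mulDr _)); apply: eq_usum => u2 v2.
exact: btensor_cat.
Qed.

(** Both sides are multiplicative for words joined by a bar, and on a single word
    the choices of left or right for each letter are the subsets S. *)
Lemma Delta_bword l : Delta (bword l) = usum btensor l.
Proof.
suff h acc : Delta (hruns acc l) = usum btensor (map Some acc ++ l) by exact: h.
elim: l acc => [|[x|] l IH] acc.
- by rewrite cats0 hruns_nil Delta_hword cop_wordE.
- by rewrite hruns_letterE IH map_rcons cat_rcons.
by rewrite usum_btensor_cat hruns_barE DeltaM (IH [::]) Delta_hword cop_wordE.
Qed.

Lemma btensor_bar : (fun u v => btensor (None :: u) (None :: v)) = btensor.
Proof.
by apply/funext => u; apply/funext => v; rewrite /btensor !bword_bar.
Qed.

Lemma Delta_prec_plus_bword l : Delta_prec_plus (bword l) = usum_prec btensor l.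
Proof.
elim: l => [|[x|] l IH].
- exact: Delta_prec_plus1.
- have h acc : Delta_prec_plus (hruns (x :: acc) l) =
      usum_prec btensor (map Some (x :: acc) ++ l); last exact: h [::].
  elim: l acc {IH} => [|[y|] l IH] acc.
  + rewrite cats0 hruns_nil -[hword _]mulr1.
    by rewrite Delta_prec_plusM Delta1 mulr1 prec_wordE.
  + by rewrite hruns_letterE rcons_cons IH -rcons_cons map_rcons cat_rcons.
  rewrite hruns_barE Delta_prec_plusM.
  by rewrite usum_prec_btensor_cat prec_wordE Delta_bword.
by rewrite bword_bar IH /= btensor_bar.
Qed.

Lemma Delta_succ_plus_bword l : Delta_succ_plus (bword l) = usum_succ btensor l.
Proof.
elim: l => [|[x|] l IH].
- exact: Delta_succ_plus1.
- have h acc : Delta_succ_plus (hruns (x :: acc) l) =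
      usum_succ btensor (map Some (x :: acc) ++ l); last exact: h [::].
  elim: l acc {IH} => [|[y|] l IH] acc.
  + rewrite cats0 hruns_nil -[hword _]mulr1.
    by rewrite Delta_succ_plusM Delta1 mulr1 succ_wordE.
  + by rewrite hruns_letterE rcons_cons IH -rcons_cons map_rcons cat_rcons.
  rewrite hruns_barE Delta_succ_plusM.
  by rewrite usum_succ_btensor_cat succ_wordE Delta_bword.
by rewrite bword_bar IH /= btensor_bar.
Qed.

(** A combination of words that has no component of degree 0 is also one of
    nonempty words: subtracting from each word its component of degree 0 does
    not change the combination. *)
Lemma tensAug_ind (P : tensAug A -> Prop) :
  P 0 -> (forall c x a w, P w -> P (c *: tword x a + w)) -> forall w, P w.
Proof.
move=> P0 Pc w.
have aug0 q : q - (teps q)%:A \in taug (V := A).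
  by rewrite inE linearB /= linearZ /= -tens_nil teps_tens mulr1 subrr.
have -> : w = TensAug (aug0 (aug_val w)).
  apply: val_inj => /=; case: w => v /=; rewrite inE => /eqP ->.
  by rewrite scale0r subr0.
elim/tens_ind: {w}(aug_val w) => [|c u q IH].
  rewrite (_ : TensAug _ = 0) //; apply: val_inj.
  by rewrite /= linear0 scale0r subr0.
case: u => [|x u].
  rewrite (_ : TensAug _ = TensAug (aug0 q)) //; apply: val_inj => /=.
  rewrite teps_linear teps_tens mulr1 scalerDl opprD addrACA tens_nil.
  by rewrite subrr add0r.
rewrite (_ : TensAug _ = c *: tword x u + TensAug (aug0 q)); first exact: Pc.
apply: val_inj => /=.
by rewrite teps_linear teps_tens mulr0 add0r addrA.
Qed.

Lemma bword_ind (P : H -> Prop) : P 0 ->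
  (forall c x y, P x -> P y -> P (c *: x + y)) ->
  (forall l, P (bword l)) -> forall x, P x.
Proof.
move=> P0 Plin Pb.
suff h ws l : P (bword l * tens ws).
  elim/tens_ind => // c u q IH; apply: Plin => //.
  by have := h u [::]; rewrite -[bword [::]]/(1 : H) mul1r.
elim: ws l => [|w ws IH] l; first by rewrite tens_nil mulr1.
have lin : multilinear (@tens k (tensAug A)) := @tens_multilinear _ _.
elim/tensAug_ind: w => [|c x a w IHw].
  have := lin [::] ws 0 0 0; rewrite /= scaler0 addr0 scale0r add0r => e.
  have e0 : tens (0 :: ws) = 0 :> H.
    have := lin [::] ws (-1) 0 0; rewrite /= scaler0 addr0 scaleN1r => ->.
    by rewrite addNr.
  by rewrite e0 mulr0.
rewrite (lin [::] ws).
have lm : linear (fun y : H => bword l * y) := tmul_linr (bword l).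
rewrite lm; apply: Plin; last exact: IHw.
rewrite -[_ ++ _ :: _]/([:: tword x a] ++ ws) tens_cat mulrA.
rewrite (_ : bword l * tens [:: tword x a] =
             bword (l ++ None :: map Some (x :: a))).
  exact: IH.
by rewrite bword_cat bword_letters.
Qed.

End WordsOfTokens.

(** * From functions of words with bars to linear forms *)

Section Transport.
Variables (k : fieldType) (A : algType k).
Local Notation H := (dtens A).
Local Notation HH := (dtens2 A).
Local Notation form := (H -> k^o).
Local Notation D := (tok_dendriform k A).
Implicit Types (f g h : form) (x : H).

Definition tok f : tokform k A := fun l => f (bword l).

Lemma scalarD f g : scalar f -> scalar g -> scalar (f + g).
Proof.
move=> lf lg a x y; rewrite -[LHS]/(f _ + g _) lf lg mulrDr.
by rewrite addrACA.
Qed.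

Lemma scalarZ c f : scalar f -> scalar (c *: f).
Proof.
move=> lf a x y; rewrite -[LHS]/(c * f _) lf mulrDr mulrCA.
by [].
Qed.

Lemma scalarN f : scalar f -> scalar (- f).
Proof. by rewrite -scaleN1r; exact: scalarZ. Qed.

Lemma scalar_eps : scalar (eps : form).
Proof. exact: teps_linear. Qed.

Lemma scalar_at0 f : scalar f -> f 0 = 0.
Proof. by move=> lf; exact: (lin0 (lf : linear f)). Qed.

Lemma tok_inj f g : scalar f -> scalar g -> tok f = tok g -> f = g.
Proof.
move=> lf lg fg; apply/funext; apply: bword_ind.
- by rewrite !scalar_at0.
- by move=> c x y hx hy; rewrite lf lg hx hy.
by move=> l; exact: (congr1 (@^~ l) fg).
Qed.

Lemma bword_deg0 l : deg l = 0%N -> bword l = 1 :> H.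
Proof.
elim: l => [_|[x|] l IH l0]; [exact: erefl|by []|].
by rewrite bword_bar IH.
Qed.

Lemma tok_aug f : f 1 = 0 -> fil D 1 (tok f).
Proof.
by move=> f1 l; rewrite ltnS leqn0 => /eqP l0; rewrite /tok bword_deg0.
Qed.

Lemma aug_tok f : fil D 1 (tok f) -> f 1 = 0.
Proof. by move=> h; exact: (h [::]). Qed.

Lemma teps1 : teps (1 : H) = 1.
Proof. by rewrite -tens_nil teps_tens. Qed.

Lemma teps_hword (x : A) (a : seq A) (y : H) : teps (hword (x :: a) * y) = 0.
Proof.
pose F (y : H) : k^o := teps (hword (x :: a) * y).
have := @tens_ext _ _ k^o F (fun=> 0) _ _ _ y; apply.
- exact: (@linear_comp k _ _ k^o _ _ (tmul_linr (hword (x :: a)))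
    (@teps_linear k _)).
- by move=> c u v; rewrite scaler0 addr0.
by move=> u; rewrite /F /hword -tens_cat teps_tens.
Qed.

Lemma tok_eps : tok eps = @tunit k A.
Proof.
apply/funext => l; rewrite /tok /eps /tunit.
elim: l => [|[x|] l IH]; first exact: teps1.
  have h acc : teps (hruns (x :: acc) l) = 0 :> k; last exact: (h [::]).
  elim: l acc {IH} => [|[y|] l IH] acc.
  - by rewrite hruns_nil -[hword _]mulr1 teps_hword.
  - by rewrite hruns_letterE rcons_cons IH.
  by rewrite hruns_barE teps_hword.
by rewrite bword_bar IH.
Qed.

Section Products.
Variables f g : form.
Hypotheses (lf : scalar f) (lg : scalar g).

Let fg_bilin : bilin (fun p : H * H => f p.1 * g p.2 : k^o).
Proof.
split=> z a x y /=; first by rewrite lf mulrDl -mulrA.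
by rewrite lg mulrDr mulrCA.
Qed.

Lemma tform_linear : linear (tform f g).
Proof. exact: plift_linear fg_bilin. Qed.

Lemma tform_tprod x y : tform f g (tprod x y) = f x * g y.
Proof. exact: (pliftE x y fg_bilin). Qed.

Lemma scalar_conv : scalar (conv f g).
Proof. exact: linear_comp (@Delta_linear k A) tform_linear. Qed.

Lemma tok_conv : tok (conv f g) = tconv (tok f) (tok g).
Proof.
apply/funext => l; rewrite /tok /conv Delta_bword.
rewrite (usum_morph (lin_add tform_linear)); apply: eq_usum => u v.
exact: tform_tprod.
Qed.

Lemma tok_prec_plus :
  (fun l => tform f g (Delta_prec_plus (bword l))) = prec D (tok f) (tok g).
Proof.
apply/funext => l; rewrite Delta_prec_plus_bword.
rewrite (usum_prec_morph (lin_add tform_linear)); apply: eq_usum_prec => u v.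
exact: tform_tprod.
Qed.

Lemma tok_succ_plus :
  (fun l => tform f g (Delta_succ_plus (bword l))) = succ D (tok f) (tok g).
Proof.
apply/funext => l; rewrite Delta_succ_plus_bword.
rewrite (usum_succ_morph (lin_add tform_linear)); apply: eq_usum_succ => u v.
exact: tform_tprod.
Qed.

End Products.

Lemma fplus_aug f : f 1 = 0 -> fplus f = f.
Proof. by move=> f1; rewrite /fplus f1 scale0r subr0. Qed.

Lemma fplus_at1 f : fplus f 1 = 0.
Proof.
have fplusE c x : (f - c *: eps) x = f x - c * eps x by [].
by rewrite /fplus fplusE /eps teps1 mulr1 subrr.
Qed.

Lemma scalar_fplus f : scalar f -> scalar (fplus f).
Proof.
by move=> lf; apply: scalarD => //; apply/scalarN/scalarZ; exact: scalar_eps.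
Qed.

Lemma tok_fplus f : tok (fplus f) = tok f - f 1 *: @tunit k A.
Proof. by rewrite -tok_eps. Qed.

(** The term a ⊗ 1 removed from the coproduct is replaced by the rule for the
    half-product with the counit. *)
Lemma half_precE f g : scalar f -> scalar g -> f 1 = 0 ->
  half_prec f g =
  (fun x => tform f (fplus g) (Delta_prec_plus x) : k^o) + g 1 *: f.
Proof.
move=> lf lg f1; rewrite /half_prec (fplus_aug f1); congr (_ + _).
apply/funext => x; rewrite /half_prec0 /Delta_prec.
have lg' := scalar_fplus lg.
rewrite (lin_sub (tform_linear lf lg')) (tform_tprod lf lg').
by rewrite fplus_at1 mulr0 subr0.
Qed.

Lemma half_succE f g : scalar f -> scalar g -> g 1 = 0 ->
  half_succ f g =
  (fun x => tform (fplus f) g (Delta_succ_plus x) : k^o) + f 1 *: g.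
Proof.
move=> lf lg g1; rewrite /half_succ (fplus_aug g1); congr (_ + _).
apply/funext => x; rewrite /half_succ0 /Delta_succ.
have lf' := scalar_fplus lf.
rewrite (lin_sub (tform_linear lf' lg)) (tform_tprod lf' lg).
by rewrite fplus_at1 mul0r subr0.
Qed.

Lemma scalar_half_prec f g : scalar f -> scalar g -> f 1 = 0 ->
  scalar (half_prec f g).
Proof.
move=> lf lg f1; rewrite half_precE //; apply: scalarD; last exact: scalarZ.
exact: (linear_comp (@Delta_prec_plus_linear k A)
  (tform_linear lf (scalar_fplus lg))).
Qed.

Lemma scalar_half_succ f g : scalar f -> scalar g -> g 1 = 0 ->
  scalar (half_succ f g).
Proof.
move=> lf lg f1; rewrite half_succE //; apply: scalarD; last exact: scalarZ.
exact: (linear_comp (@Delta_succ_plus_linear k A)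
  (tform_linear (scalar_fplus lf) lg)).
Qed.

Lemma tok_half_prec f g : scalar f -> scalar g -> f 1 = 0 ->
  tok (half_prec f g) = prec D (tok f) (tok g).
Proof.
move=> lf lg f1; rewrite half_precE // -[LHS]/((fun l => _) + g 1 *: tok f).
rewrite (tok_prec_plus lf (scalar_fplus lg)) tok_fplus.
rewrite (lin_sub (prec_linr D _)) (lin_scale (prec_linr D _)).
by rewrite (prec1r (tok_aug f1)) subrK.
Qed.

Lemma tok_half_succ f g : scalar f -> scalar g -> g 1 = 0 ->
  tok (half_succ f g) = succ D (tok f) (tok g).
Proof.
move=> lf lg g1; rewrite half_succE // -[LHS]/((fun l => _) + f 1 *: tok g).
rewrite (tok_succ_plus (scalar_fplus lf) lg) tok_fplus.
rewrite (lin_sub (succ_linl D _)) (lin_scale (succ_linl D _)).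
by rewrite (succ1l (tok_aug g1)) subrK.
Qed.

(** The linear forms on H^+, extended by 0 at the unit. *)
Definition augmented f := scalar f /\ f 1 = 0.

Lemma augmentedN f : augmented f -> augmented (- f).
Proof.
by case=> lf f1; split; [exact: scalarN|rewrite -[LHS]/(- f 1) f1 oppr0].
Qed.

Lemma prelie_spec f g : augmented f -> augmented g ->
  augmented (prelie f g) /\ tok (prelie f g) = dprelie D (tok f) (tok g).
Proof.
move=> [lf f1] [lg g1].
have e : tok (prelie f g) = dprelie D (tok f) (tok g).
  by rewrite /dprelie -tok_half_succ // -tok_half_prec.
split=> //; split.
  by apply: scalarD; [|apply: scalarN];
     [exact: scalar_half_succ|exact: scalar_half_prec].
apply: aug_tok; rewrite e.
by apply: (@filW _ _ D); apply: (fil_pl (tok_aug f1) (tok_aug g1)).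
Qed.

Lemma iter_prelie_spec f g n : augmented f -> augmented g ->
  augmented (iter n (prelie f) g) /\
  tok (iter n (prelie f) g) = iter n (dprelie D (tok f)) (tok g).
Proof.
move=> af ag; elim: n => [|n [an e]] //=.
by rewrite -e; exact: prelie_spec.
Qed.

Lemma fsum_trunc (u : nat -> form) x N : (forall n, (N <= n)%N -> u n x = 0) ->
  fsum u x = \sum_(n < N) u n x.
Proof.
move=> uN; rewrite /fsum (fsbig_ord _ N (fun n => u n x)).
apply/esym/fsbig_widen => // n [_ /negP]; rewrite -leqNgt; exact: uN.
Qed.

(** At each element only finitely many terms are nonzero: this holds on words
    with bars by degree, and in general by linearity. *)
Lemma fsum_spec (u : nat -> form) :
  (forall n, scalar (u n)) -> (forall n, fil D n (tok (u n))) ->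
  scalar (fsum u) /\ sums D (fun n => tok (u n)) (tok (fsum u)).
Proof.
move=> lu u_fil.
have ev : forall x, exists N, forall n, (N <= n)%N -> u n x = 0.
  apply: bword_ind => [|c x y [p hp] [q hq]|l].
  - by exists 0%N => n _; exact: scalar_at0.
  - exists (maxn p q) => n; rewrite geq_max => /andP[pn qn].
    by rewrite lu hp // hq // mulr0 addr0.
  by exists (deg l).+1 => n; exact: u_fil.
split=> [a x y|N l lN].
  have [[p hp] [q hq]] := (ev x, ev y).
  have hx n : (maxn p q <= n)%N -> u n x = 0.
    by rewrite geq_max => /andP[/hp].
  have hy n : (maxn p q <= n)%N -> u n y = 0.
    by rewrite geq_max => /andP[_ /hq].
  rewrite (fsum_trunc hx) (fsum_trunc hy) (@fsum_trunc _ _ (maxn p q)).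
    by rewrite mulr_sumr -big_split; apply: eq_bigr => n _; exact: lu.
  by move=> n hn; rewrite lu hx // hy // mulr0 addr0.
rewrite -[LHS]/(fsum u (bword l) - (\sum_(n < N) tok (u n)) l) fct_sumE.
rewrite (@fsum_trunc _ _ N) ?subrr // => n Nn.
by apply: u_fil; exact: leq_trans Nn.
Qed.

Lemma sums_ext u v (x : tokform k A) : u =1 v -> sums D u x -> sums D v x.
Proof. by move=> uv; rewrite (funext uv). Qed.

Lemma iter_conv_spec f n : augmented f ->
  scalar (iter n (conv f) eps) /\
  tok (iter n (conv f) eps) = iter n (dmul D (tok f)) (dunit D).
Proof.
move=> [lf f1]; elim: n => [|n [ln e]] /=.
  by split; [exact: scalar_eps|exact: tok_eps].
split; first exact: scalar_conv.
rewrite tok_conv // e; apply: tconv_split; left; exact: tok_aug.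
Qed.

Lemma exp_conv_spec f : augmented f ->
  scalar (exp_conv f) /\ sums D (exp_term D (tok f)) (tok (exp_conv f)).
Proof.
move=> af; pose u n : form := (n`!%:R)^-1 *: iter n (conv f) eps.
have e n : tok (u n) = exp_term D (tok f) n.
  by rewrite /exp_term -(iter_conv_spec n af).2.
have [||sc su] := @fsum_spec u.
- by move=> n; apply/scalarZ/(iter_conv_spec n af).1.
- by move=> n; rewrite e; apply/exp_term_fil/tok_aug/af.2.
by split=> //; apply: sums_ext su.
Qed.

Lemma Wmap_spec f : augmented f ->
  augmented (Wmap f) /\ sums D (W_term D (tok f)) (tok (Wmap f)).
Proof.
move=> af; pose u n : form := (n.+1`!%:R)^-1 *: iter n (prelie f) f.
have f1 := tok_aug af.2.
have e n : tok (u n) = W_term D (tok f) n.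
  by rewrite /W_term -(iter_prelie_spec n af af).2.
have [||sc su] := @fsum_spec u.
- by move=> n; apply/scalarZ; case: (iter_prelie_spec n af af).1.
- by move=> n; rewrite e; apply/(@filW _ _ D)/W_term_fil.
have su' := sums_ext e su; split=> //; split=> //; apply: aug_tok.
by apply: (sums_fil su') => n; rewrite addn1; exact: W_term_fil.
Qed.

Lemma magnus_sum_spec f g : augmented f -> augmented g ->
  let h : form :=
    fsum (fun m => (bernoulli k m / m`!%:R) *: iter m (prelie g) f) in
  scalar h /\ sums D (magnus_term D (tok g) (tok f)) (tok h).
Proof.
move=> af ag.
pose u m : form := (bernoulli k m / m`!%:R) *: iter m (prelie g) f.
have e n : tok (u n) = magnus_term D (tok g) (tok f) n.
  by rewrite /magnus_term -(iter_prelie_spec n ag af).2.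
have [||sc su] := @fsum_spec u.
- by move=> n; apply/scalarZ; case: (iter_prelie_spec n ag af).1.
- move=> n; rewrite e; apply/filZ/(@filW _ _ D); rewrite -addn1.
  by apply: fil_iter_pl; [exact: tok_aug ag.2|exact: tok_aug af.2].
by split=> //; apply: sums_ext su.
Qed.

Hypothesis char0 : [pchar k] =i pred0.

(** By magnus_W, f solves the recursion for Wmap f; by magnus_unique it is the
    only solution. *)
Lemma Omega_Wmap f : augmented f -> Omega (Wmap f) = f.
Proof.
move=> af; have [aW sW] := Wmap_spec af.
apply: xget_unique => [|g [lg g1 gE]].
  split; [exact: af.1|exact: af.2|].
  have [sh hh] := magnus_sum_spec aW af.
  apply: (tok_inj af.1 sh).
  exact: (sums_unique (magnus_W char0 (tok_aug af.2) sW) hh).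
have ag : augmented g by [].
have [sh hh] := magnus_sum_spec aW ag; rewrite -gE in hh.
apply: (tok_inj lg af.1); apply: (magnus_unique _ _ _ hh).
- exact: tok_aug aW.2.
- exact: tok_aug g1.
- exact: tok_aug af.2.
exact: (magnus_W char0 (tok_aug af.2) sW).
Qed.

Lemma exp_prec_fixpoint f (x : form) : augmented f -> scalar x ->
  x = eps + half_prec f x -> x = exp_prec f.
Proof.
move=> af lx xE; pose u n : form := iter n.+1 (half_prec f) eps.
have sp n : scalar (iter n (half_prec f) eps) /\
    tok (iter n (half_prec f) eps) = iter n (prec D (tok f)) (dunit D).
  case: af => lf f1; elim: n => [|n [ln e]].
    by split; [exact: scalar_eps|exact: tok_eps].
  by rewrite !iterS -e -tok_half_prec //; split=> //; exact: scalar_half_prec.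
have f1 := tok_aug af.2.
have [||sc su] := @fsum_spec u.
- by move=> n; exact: (sp n.+1).1.
- move=> n; rewrite (sp n.+1).2; exact/filW/fil_iter_prec.
rewrite /exp_prec -[fsum _]/(fsum u).
have h : tok x - tok eps = tok (fsum u).
  apply: (sums_unique _ su).
  apply: sums_ext => [n|]; first exact/esym/(sp n.+1).2.
  rewrite tok_eps; apply: sums_prec_fixpoint => //.
  by rewrite -(tok_half_prec af.1 lx af.2) {1}xE -[dunit D]tok_eps.
apply: (tok_inj lx); first by apply: scalarD sc; exact: scalar_eps.
by rewrite -[RHS]/(tok eps + tok (fsum u)) -h addrC subrK.
Qed.

(** This is the previous argument in the opposite dendriform algebra. *)
Lemma exp_succ_fixpoint f (x : form) : augmented f -> scalar x ->
  x = eps + half_succ x f -> x = exp_succ f.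
Proof.
move=> af lx xE; pose u n : form := iter n.+1 (fun y => half_succ y f) eps.
pose D' := dendriform_op D.
have sp n : scalar (iter n (fun y => half_succ y f) eps) /\
    tok (iter n (fun y => half_succ y f) eps) =
      iter n (prec D' (tok f)) (dunit D').
  case: af => lf f1; elim: n => [|n [ln e]].
    by split; [exact: scalar_eps|exact: tok_eps].
  rewrite !iterS -e -[prec D' _ _]tok_half_succ //; split=> //.
  exact: scalar_half_succ.
have f1 := tok_aug af.2.
have [||sc su] := @fsum_spec u.
- by move=> n; exact: (sp n.+1).1.
- move=> n; rewrite (sp n.+1).2; exact/(@filW _ _ D')/fil_iter_prec.
rewrite /exp_succ -[fsum _]/(fsum u).
have h : tok x - tok eps = tok (fsum u).
  apply: (sums_unique _ su).
  apply: sums_ext => [n|]; first exact/esym/(sp n.+1).2.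
  rewrite tok_eps; apply: (@sums_prec_fixpoint _ _ D') => //.
  by rewrite -[prec D' _ _](tok_half_succ lx af.1 af.2) {1}xE -[dunit D']tok_eps.
apply: (tok_inj lx); first by apply: scalarD sc; exact: scalar_eps.
by rewrite -[RHS]/(tok eps + tok (fsum u)) -h addrC subrK.
Qed.

Lemma free_cumulant_Wmap (x r f : form) :
  augmented r -> augmented f -> x = exp_conv r ->
  x = eps + half_prec f x -> f = Wmap r.
Proof.
move=> ar af -> fE; have [sx hx] := exp_conv_spec ar.
have [aW hW] := Wmap_spec ar.
apply: (tok_inj af.1 aW.1).
apply: (free_cumulants char0 (tok_aug ar.2) hx (tok_aug af.2) _ hW).
by rewrite -(tok_half_prec af.1 sx af.2) {1}fE -[dunit D]tok_eps.
Qed.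

Lemma boolean_cumulant_Wmap (x r f : form) :
  augmented r -> augmented f -> x = exp_conv r ->
  x = eps + half_succ x f -> f = - Wmap (- r).
Proof.
move=> ar af -> fE; have [sx hx] := exp_conv_spec ar.
have [aW hW] := Wmap_spec (augmentedN ar).
apply: (tok_inj af.1 (scalarN aW.1)).
apply: (boolean_cumulants char0 (tok_aug ar.2) hx (tok_aug af.2) _ hW).
by rewrite -(tok_half_succ sx af.1 af.2) {1}fE -[dunit D]tok_eps.
Qed.

End Transport.

(** * The relations between the three families of cumulants *)

Theorem theorem14 (k : fieldType) (char0 : [pchar k] =i pred0)
    (A : algType k) (phi : {scalar A}) (phi1 : phi 1 = 1)
    (kappa beta rho : dtens A -> k^o)
    (kappa_inf : infinitesimal_character kappa)
    (beta_inf : infinitesimal_character beta)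
    (rho_inf : infinitesimal_character rho)
    (kappaE : Phi phi = eps + half_prec kappa (Phi phi))
    (betaE : Phi phi = eps + half_succ (Phi phi) beta)
    (rhoE : Phi phi = exp_conv rho) :
  ([/\ Phi phi = exp_prec kappa,
       Phi phi = exp_conv (Omega kappa) &
       Phi phi = exp_succ (- Wmap (- Omega kappa))] /\
   [/\ Phi phi = exp_succ beta,
       Phi phi = exp_conv (- Omega (- beta)) &
       Phi phi = exp_prec (Wmap (- Omega (- beta)))] /\
   [/\ Phi phi = exp_conv rho,
       Phi phi = exp_prec (Wmap rho) &
       Phi phi = exp_succ (- Wmap (- rho))]) /\
  [/\ rho = Omega kappa /\ beta = - Wmap (- Omega kappa),
      rho = - Omega (- beta) /\ kappa = Wmap (- Omega (- beta)) &
      kappa = Wmap rho /\ beta = - Wmap (- rho)].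
Proof.
have aug (f : dtens A -> k^o) : infinitesimal_character f -> augmented f by case.
have ak := aug _ kappa_inf; have ab := aug _ beta_inf; have ar := aug _ rho_inf.
have kW := free_cumulant_Wmap char0 ar ak rhoE kappaE.
have bW := boolean_cumulant_Wmap char0 ar ab rhoE betaE.
have sP : scalar (Phi phi) by rewrite rhoE; exact: (exp_conv_spec ar).1.
have Pk := exp_prec_fixpoint ak sP kappaE.
have Pb := exp_succ_fixpoint ab sP betaE.
have Ok : Omega kappa = rho by rewrite kW; exact: Omega_Wmap.
have Ob : - Omega (- beta) = rho.
  by rewrite bW opprK (Omega_Wmap char0 (augmentedN ar)) opprK.
by rewrite Ok Ob -kW -bW; do !split.
Qed.
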